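(* Let $n \in \mathbb{N}$ and let $a \in \mathbb{Z}$ satisfy $a \geq -n$. If $T \colon \mathbb{Q}^{\mathbb{N}} \to \mathbb{Q}^{\mathbb{N}}$ is the linear operator defined by $$\bigl(T[h]\bigr)(j) := (n+j+1)\,h(j) - (j+1)\,h(j+1)$$ for $h \colon \mathbb{N} \to \mathbb{Q}$ and $j \in \mathbb{N}$, then the image $T[Q_{n,a}]$ equals the closed convex hull of $\mathbb{N}^{\mathbb{N}} \cap V_{n,a}$ in $V_{n,a}$.
   Context: $\mathbb{N}$ is the set of non-negative integers, $\Bbbk$ is an arbitrary field, and $S := \Bbbk[x_0, x_1, \dotsc, x_n]$ has the standard $\mathbb{N}$-grading with $\deg(x_i)=1$. For a finitely generated $\mathbb{N}$-graded $S$-module $M$, the Hilbert function is $h_M(j) := \dim_{\Bbbk} M_j$ for $j \in \mathbb{N}$. $V_{n,a} \subset \mathbb{Q}^{\mathbb{N}}$ is the finite-dimensional $\mathbb{Q}$-subspace of all functions $h \colon \mathbb{N} \to \mathbb{Q}$ such that $\sum_{j \in \mathbb{N}} h(j) t^j = (b_0 + b_1 t + \dotsb + b_{a+n} t^{a+n})/(1-t)^n$ for some $b_0, b_1, \dotsc, b_{a+n} \in \mathbb{Q}$. $Q_{n,a}$ denotes the closed convex hull in $V_{n,a}$ of the Hilbert functions (lying in $V_{n,a}$) of finitely generated $\mathbb{N}$-graded $S$-modules that are generated in degree zero and have no free summands (i.e. $\dim(M) < n+1$). The topology on the finite-dimensional $\mathbb{Q}$-vector space $V_{n,a}$ is the usual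 Euclidean one. *)

(* Defs.v *)
From HB Require Import structures.
From mathcomp Require Import all_boot all_order all_algebra ring_quotient.
From mathcomp Require Import all_classical.
From mathcomp Require Import topology normedtype convex.
(* The notations of mpoly clash with those of MathComp-Analysis:
   mpoly n R is {mpoly R[n]}, mpolyC n c is c%:MP, ishomog1 d mdeg is
   d.-homog. *)
From mathcomp Require Import -(notations) mpoly.
Import numFieldNormedType.Exports.

Set Implicit Arguments.
Unset Strict Implicit.
Unset Printing Implicit Defensive.

Import Order.TTheory GRing.Theory Num.Theory.

Local Open Scope classical_set_scope.
Local Open Scope ring_scope.

(* S = k[x_0, ..., x_n], in n + 1 variables. *)
Notation polyS k n := (mpoly n.+1 k).

Record graded_module (k : fieldType) (n : nat) := GradedModule {
  gm_sort :> lmodType (polyS k n);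
  gm_piece : nat -> set gm_sort;
  gm_piece0 : forall j, gm_piece j 0;
  gm_pieceB : forall j x y, gm_piece j x -> gm_piece j y -> gm_piece j (x - y);
  gm_pieceZ : forall i j (p : polyS k n) x,
    p \is ishomog1 i mdeg -> gm_piece j x -> gm_piece (i + j)%N (p *: x);
  gm_span : forall x : gm_sort, exists (d : nat) (f : nat -> gm_sort),
    (forall j, gm_piece j (f j)) /\ x = \sum_(j < d) f j;
  gm_direct : forall (d : nat) (f : nat -> gm_sort),
    (forall j, gm_piece j (f j)) -> \sum_(j < d) f j = 0 ->
    forall j, (j < d)%N -> f j = 0 }.

Arguments gm_piece {k n} g j _ : rename.

Section GradedModules.
Variables (k : fieldType) (n : nat) (M : graded_module k n).

Definition generates (A : set M) : Prop :=
  forall x : M, exists (r : nat) (c : 'I_r -> polyS k n) (g : 'I_r -> M),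
    (forall i, A (g i)) /\ x = \sum_(i < r) c i *: g i.

Definition finitely_generated : Prop :=
  exists A : set M, finite_set A /\ generates A.

Definition generated_in_degree_zero : Prop := generates (gm_piece M 0%N).

(* d is the dimension over k of the k-subspace W: W has a basis of d vectors. *)
Definition has_dim (W : set M) (d : nat) : Prop :=
  exists e : 'I_d -> M, (forall i, W (e i)) /\
    forall x, W x ->
      exists! c : {ffun 'I_d -> k}, x = \sum_(i < d) mpolyC n.+1 (c i) *: e i.

Definition annihilates (p : polyS k n) : Prop := forall x : M, p *: x = 0.

Definition prime_ideal (P : {pred polyS k n}) : Prop :=
  idealr_closed P /\ prime_idealr_closed P.

(* The Krull dimension of M is that of S / Ann M, so dim M >= d means that there
   are d + 1 primes P_0 < ... < P_d of S containing Ann M.  The zero module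
   has no such chain, not even for d = 0. *)
Definition krull_dim_ge (d : nat) : Prop :=
  exists P : nat -> {pred polyS k n},
    (forall i, (i <= d)%N ->
       prime_ideal (P i) /\ forall p, annihilates p -> p \in P i) /\
    (forall i, (i < d)%N ->
       {subset P i <= P i.+1} /\ ~ {subset P i.+1 <= P i}).

Definition krull_dim_lt (d : nat) : Prop := ~ krull_dim_ge d.

Definition is_hilbert_function (h : nat -> rat) : Prop :=
  forall j, exists2 d : nat, has_dim (gm_piece M j) d & h j = d%:R.

End GradedModules.

(* The coefficient of t^j in (1 - t)^n * \sum_j h(j) t^j. *)
Definition numerator (n : nat) (h : nat -> rat) (j : nat) : rat :=
  \sum_(i < j.+1) ((1 - 'X : {poly rat}) ^+ n)`_i * h (j - i)%N.

(* The absolute value `|a + n| is a + n, as a natural number, if a >= - n. *)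
Definition V (n : nat) (a : int) : set (nat -> rat) :=
  [set h | exists b : {poly rat},
     (size b <= `|(a + n%:Z)%R|.+1)%N /\ forall j, numerator n h j = b`_j].

(* The linear map h |-> (b_0, ..., b_(a + n)), an isomorphism on V n a. *)
Definition V_coord (n : nat) (a : int) (h : nat -> rat) :
    'rV[rat^o]_(`|(a + n%:Z)%R|.+1) :=
  \row_i numerator n h i.

(* The closed convex subsets of V n a, whose Euclidean topology is that of the
   coordinates b_0, ..., b_(a + n); scalars are rational. *)
Definition closed_convex_in_V (n : nat) (a : int) (C : set (nat -> rat)) : Prop :=
  [/\ C `<=` V n a,
      @convex_set rat (nat -> rat^o)%type C
    & closed (V_coord n a @` C)].

Definition closed_convex_hull (n : nat) (a : int) (A : set (nat -> rat)) :
    set (nat -> rat) :=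
  smallest (closed_convex_in_V n a) A.

Definition hilbert_functions (k : fieldType) (n : nat) : set (nat -> rat) :=
  [set h | exists M : graded_module k n,
     [/\ finitely_generated M, generated_in_degree_zero M,
         krull_dim_lt M n.+1 & is_hilbert_function M h]].

Definition Q (k : fieldType) (n : nat) (a : int) : set (nat -> rat) :=
  closed_convex_hull n a (hilbert_functions k n `&` V n a).

Definition T (n : nat) (h : nat -> rat) : nat -> rat :=
  fun j => (n + j + 1)%N%:R * h j - (j + 1)%N%:R * h (j + 1)%N.

Definition nat_valued : set (nat -> rat) :=
  [set h | forall j, h j \is a Num.nat].

(* Main.v *)
(* Let P be the convex cone of all nonnegative functions in V n a.  It is
   closed, and it is the closed convex hull of N^N /\ V n a, since a function in
   V n a has bounded denominators.

   T maps Hilbert functions into P.  If M is generated in degree zero, the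
   monomials x^m e_l that are not combinations of smaller ones of the same degree
   form bases of the pieces of M, and they are closed under division.
   Multiplying the number of those of degree j+1 by j+1 counts each one with the
   sum of its exponents; the contribution of the variable x_i is at most the sum
   of m_i + 1 over those of degree j, whence (j+1) h(j+1) <= (n+1+j) h(j).

   Conversely, let nabla be the backward difference, so that V n a is the space
   of all h such that nabla^n h vanishes beyond a+n, and let psum be its inverse.
   A nonnegative g such that nabla^n g is eventually zero is a nonnegative
   combination of the functions psum^p delta_e with p <= n: all nabla^i g are
   eventually nonnegative, and one peels off values of g, nabla g, nabla^2 g,
   ... far out.  Since nabla (T_(n+1) h) = T_n (nabla h), the Hilbert function of
   S/(x_0, ..., x_q)^(e+1) is mapped by T to a positive multiple of
   psum^(n-q) delta_e.  Hence a multiple of g is the image of the Hilbert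
   function of a direct sum of such quotients.  These are torsion modules, thus
   of dimension less than n+1. *)
From HB Require Import structures.
Require Import Defs.
From mathcomp Require Import all_boot all_order all_algebra all_classical.
From mathcomp Require Import ring_quotient interval_inference.
From mathcomp Require Import topology normedtype convex.
From mathcomp Require Import -(notations) mpoly.
From mathcomp Require Import ring lra zify.
Import numFieldNormedType.Exports.

Set Implicit Arguments.
Unset Strict Implicit.
Unset Printing Implicit Defensive.

Import Order.TTheory GRing.Theory Num.Theory.

Local Open Scope classical_set_scope.
Local Open Scope ring_scope.

(** * Backward differences and prefix sums *)

Definition nabla (h : nat -> rat) (j : nat) : rat :=
  h j - (if j is i.+1 then h i else 0).
Definition psum (h : nat -> rat) (j : nat) : rat := \sum_(i < j.+1) h i.
Definition delta (e j : nat) : rat := (j == e)%:R.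

Lemma psumS h j : psum h j.+1 = psum h j + h j.+1.
Proof. by rewrite /psum big_ord_recr. Qed.

Lemma nablaK : cancel nabla psum.
Proof.
move=> h; apply/funext; elim=> [|j IH]; first by rewrite /psum big_ord1 /nabla subr0.
by rewrite psumS IH /nabla addrC subrK.
Qed.

Lemma psumK : cancel psum nabla.
Proof.
move=> h; apply/funext=> -[|j]; first by rewrite /nabla /psum big_ord1 subr0.
by rewrite /nabla psumS [psum h j + _]addrC addrK.
Qed.

Lemma iter_nablaK n : cancel (iter n nabla) (iter n psum).
Proof. by elim: n => // n IH h; rewrite iterSr iterS nablaK IH. Qed.

Lemma iter_psumK n : cancel (iter n psum) (iter n nabla).
Proof. by elim: n => // n IH h; rewrite iterSr iterS psumK IH. Qed.

Lemma psum_comb (c d : rat) f g :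
  psum (fun j => c * f j + d * g j) = (fun j => c * psum f j + d * psum g j).
Proof. by apply/funext=> j; rewrite /psum big_split/= -!mulr_sumr. Qed.

Lemma nabla_comb (c d : rat) f g :
  nabla (fun j => c * f j + d * g j) = (fun j => c * nabla f j + d * nabla g j).
Proof. by apply/funext=> -[|j]; rewrite /nabla; ring. Qed.

Lemma iter_nabla_comb n (c d : rat) f g :
  iter n nabla (fun j => c * f j + d * g j) =
  (fun j => c * iter n nabla f j + d * iter n nabla g j).
Proof. by elim: n => // n IH; rewrite !iterS IH nabla_comb. Qed.

Lemma numeratorE n h : numerator n h = iter n nabla h.
Proof.
elim: n => [|n IH] in h *.
  apply/funext=> j; rewrite /numerator big_ord_recl expr0 coef1/= mul1r subn0.
  by rewrite big1 ?addr0// => i _; rewrite coef1/= mul0r.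
rewrite iterSr -IH; apply/funext=> j.
rewrite /numerator.
(* The coefficient of degree [j] only sees [g] up to [j], so its power series may be cut to a
   polynomial at any [K >= j]. *)
have E m (g : nat -> rat) K : (j <= K)%N ->
  \sum_(i < j.+1) ((1 - 'X) ^+ m)`_i * g (j - i)%N
  = ((1 - 'X) ^+ m * \poly_(i < K.+1) g i)`_j :> rat.
  move=> jK; rewrite coefM; apply: eq_bigr => i _; rewrite coef_poly.
  by rewrite ltnS (leq_trans (leq_subr _ _) jK).
rewrite !(E _ _ j)// exprSr -mulrA !coefM; apply: eq_bigr => i _; congr (_ * _).
rewrite mulrBl mul1r coefB coefXM !coef_poly ltnS leq_subr /nabla.
have := ltn_ord i; case: (j - i)%N (leq_subr i j) => [|k] kj _ //=.
by rewrite ltnS (ltnW kj).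
Qed.

(** Each difference lowers the index of [T] by one, which reduces questions on [T n] to the simple
    operator [T 0]. *)
Lemma nabla_T n h : nabla (T n.+1 h) = T n (nabla h).
Proof.
have S (i : nat) : i.+1%:R = i%:R + 1 :> rat by rewrite natr1.
apply/funext=> -[|j]; rewrite /nabla /T /= ?addn1 ?addn0 ?addnS ?addSn !S ?natrD.
  by ring.
by ring.
Qed.

Lemma iter_nabla_T p q h : iter p nabla (T (p + q) h) = T q (iter p nabla h).
Proof. by elim: p h => // p IH h; rewrite !iterSr addSn nabla_T IH. Qed.

Lemma T0E h j : T 0 h j = j.+1%:R * (h j - h j.+1).
Proof. by rewrite /T add0n addn1 mulrBr. Qed.

(** * Eventual signs and generators of the cone of nonnegative functions *)

Definition eventually_zero (g : nat -> rat) := exists J, forall j, (J <= j)%N -> g j = 0.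

Lemma eventually_zero_nabla g : eventually_zero g -> eventually_zero (nabla g).
Proof.
move=> [J HJ]; exists J.+1 => -[|j]// Jj.
by rewrite /nabla !HJ ?subr0// ltnW.
Qed.

Lemma nabla_unbounded g (c B : rat) J : 0 < c ->
  (forall j, (J <= j)%N -> c <= nabla g j) ->
  exists J', forall j, (J' <= j)%N -> B <= g j.
Proof.
move=> c0 H.
have G i : g J + i%:R * c <= g (J + i)%N.
  elim: i => [|i IH]; first by rewrite mul0r addr0 addn0.
  have := H (J + i.+1)%N (leq_addr _ _); rewrite addnS /nabla => Hi.
  by rewrite -natr1; lra.
have [k Hk] : exists k : nat, B - g J <= k%:R * c.
  exists (Num.bound `|(B - g J) / c|); rewrite -ler_pdivrMr//.
  by apply/ltW/(le_lt_trans (ler_norm _)); exact: archi_boundP.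
exists (J + k)%N => j Jkj; have {1}-> : j = (J + (j - J))%N by lia.
apply: le_trans (G _); rewrite -lerBlDl; apply: le_trans Hk _.
by rewrite ler_pM2r// ler_nat; lia.
Qed.

(** A difference bounded away from 0 makes [g] unbounded with the same sign; an eventually zero one
    makes [g] eventually constant, and the constant has a sign. The gap [c] carries the
    induction. *)
Lemma nabla_iter_sign n g : eventually_zero (iter n nabla g) ->
  [\/ exists2 c, 0 < c & exists J, forall j, (J <= j)%N -> c <= g j,
      eventually_zero g
    | exists2 c, 0 < c & exists J, forall j, (J <= j)%N -> g j <= - c].
Proof.
elim: n g => [|n IH] g; first by move=> z; apply: Or32.
rewrite iterSr => /IH[[c c0 [J HJ]]|[J HJ]|[c c0 [J HJ]]].
- by apply: Or31; exists 1 => //; apply: nabla_unbounded c0 HJ.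
- have G i : g (J + i)%N = g J.
    elim: i => [|i IHi]; first by rewrite addn0.
    have := HJ (J + i.+1)%N (leq_addr _ _); rewrite addnS /nabla => /eqP.
    by rewrite subr_eq0 => /eqP->.
  have {}G j : (J <= j)%N -> g j = g J by move=> /subnKC<-.
  have [gJ|gJ|gJ] := ltgtP (g J) 0.
  + apply: Or33; exists (- g J); first by rewrite oppr_gt0.
    by exists J => j /G->; rewrite opprK.
  + by apply: Or31; exists (g J) => //; exists J => j /G->.
  + by apply: Or32; exists J => j /G->.
- apply: Or33; exists 1 => //.
  have [|J' HJ'] := @nabla_unbounded (fun j => - g j) c 1 J c0.
    move=> j /HJ; case: j => [|j]; rewrite /nabla; lra.
  by exists J' => j /HJ'; lra.
Qed.

Definition eventually_ge0 (g : nat -> rat) := exists J, forall j, (J <= j)%N -> 0 <= g j.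

(** By the trichotomy, [nabla g] could only fail by staying below some [- c], which would drive [g]
    below 0. *)
Lemma eventually_ge0_nabla n g : eventually_zero (iter n nabla g) ->
  eventually_ge0 g -> eventually_ge0 (nabla g).
Proof.
move=> zg [J0 HJ0].
have : eventually_zero (iter n nabla (nabla g)).
  by rewrite -iterSr iterS; apply: eventually_zero_nabla.
move=> /nabla_iter_sign[[c c0 [J HJ]]|[J HJ]|[c c0 [J HJ]]].
- by exists J => j /HJ; apply/le_trans/ltW.
- by exists J => j /HJ->.
- have [|J' HJ'] := @nabla_unbounded (fun j => - g j) c 1 J c0.
    move=> j /HJ; case: j => [|j]; rewrite /nabla; lra.
  have := HJ' (J0 + J')%N (leq_addl _ _).
  have := HJ0 (J0 + J')%N (leq_addr _ _); lra.
Qed.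

Definition cone_closed (K : (nat -> rat) -> Prop) :=
  K (fun=> 0) /\ forall (c d : rat) f g, 0 <= c -> 0 <= d -> K f -> K g ->
    K (fun j => c * f j + d * g j).

Definition tail (D : nat) (g : nat -> rat) (j : nat) : rat :=
  if (D <= j)%N then g j else 0.

Lemma nabla_tail D g :
  nabla (tail D g) = (fun j => g D * delta D j + 1 * tail D.+1 (nabla g) j).
Proof.
apply/funext=> -[|j]; rewrite /nabla /tail /delta.
  case: D => [|D]; rewrite /= ?mulr0 ?mulr1 ?addr0 ?subr0 //.
rewrite -(ltnS D j).
by case: (ltngtP D j.+1) => [_|_|->] /=; ring.
Qed.

(* [tail D g] is [g D] times the prefix sums of [delta D], plus the prefix sums
   of [tail D.+1 (nabla g)]. *)
Lemma cone_tail n g K : cone_closed K ->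
  (forall p e, (p <= n)%N -> K (iter p psum (delta e))) ->
  eventually_zero (iter n nabla g) -> eventually_ge0 g ->
  exists J, forall D, (J <= D)%N -> K (tail D g).
Proof.
elim: n g K => [|n IH] g K [K0 Kc] Kb.
  move=> [J HJ] _; exists J => D JD.
  rewrite (_ : tail D g = fun=> 0)//; apply/funext=> j; rewrite /tail.
  by case: ifP => // Dj; apply: HJ; apply: leq_trans Dj.
move=> zg pg; have [J0 HJ0] := pg.
(* The induction hypothesis is applied to the preimage of the cone under [psum], which contains the
   generators with one prefix sum fewer. *)
have [||||J HJ] := IH (nabla g) (fun f => K (psum f)).
- split=> [|c d f h c0 d0 Kf Kh]; last by rewrite psum_comb; apply: Kc.
  rewrite (_ : psum _ = fun=> 0)//.
  by apply/funext=> j; rewrite /psum big1.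
- by move=> p e pn; rewrite -iterS; apply: Kb.
- by rewrite -iterSr.
- exact: eventually_ge0_nabla zg pg.
exists (maxn J J0) => D; rewrite geq_max => /andP[JD J0D].
rewrite -[tail D g]nablaK nabla_tail psum_comb.
apply: Kc => //; [exact: HJ0|exact: (Kb 1)|].
exact/HJ/leqW.
Qed.

(** Values below a threshold are peeled off as multiples of [delta]; the rest is a tail, covered by
    [cone_tail]. *)
Lemma cone_generators n g K : cone_closed K ->
  (forall p e, (p <= n)%N -> K (iter p psum (delta e))) ->
  eventually_zero (iter n nabla g) -> (forall j, 0 <= g j) -> K g.
Proof.
move=> HK Kb zg pg; have [K0 Kc] := HK.
have [|J /(_ _ (leqnn _)) HJ] := cone_tail HK Kb zg; first by exists 0.
have Hh D : K (fun j => if (j < D)%N then g j else 0).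
  elim: D => [|D IH]; first exact: K0.
  rewrite (_ : (fun j => _) =
    fun j => 1 * (if (j < D)%N then g j else 0) + g D * delta D j).
    by apply: Kc => //; apply: (Kb 0).
  apply/funext=> j; rewrite /delta ltnS.
  by case: (ltngtP j D) => [_|_|->] /=; ring.
rewrite (_ : g = fun j => 1 * (if (j < J)%N then g j else 0) + 1 * tail J g j).
  exact: Kc.
by apply/funext=> j; rewrite /tail; case: leqP => _; ring.
Qed.

(** * The operator on truncated Hilbert functions of polynomial rings *)

Lemma psum_delta0 : psum (delta 0) = fun=> 1.
Proof.
apply/funext; elim=> [|j IH]; first by rewrite /psum big_ord1 /delta.
by rewrite psumS IH /delta addr0.
Qed.

(** [A] is the Hilbert function of a polynomial ring in [q.+1] variables. Its [q]-th difference is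
    constant, which [T 0] kills, and differences are injective. *)
Lemma T_eq0 q (A : nat -> rat) :
  iter q.+1 nabla A = delta 0 -> forall j, T q A j = 0.
Proof.
rewrite iterS => HA0.
have {}HA : iter q nabla A = fun=> 1 by rewrite -[LHS]nablaK HA0 psum_delta0.
have := iter_nabla_T q 0 A; rewrite addn0 HA.
rewrite (_ : T 0 (fun=> 1) = fun=> 0); last first.
  by apply/funext=> j; rewrite T0E subrr mulr0.
move=> /(congr1 (iter q psum)); rewrite iter_nablaK => -> j.
elim: q {HA0 HA} j => // q IH j.
by rewrite iterS /psum big1.
Qed.

(** The [p]-th difference of the left side is [T q] of a truncation of [A]. It agrees with
    [T q A = 0] below [e] and vanishes above; at [e] the subtracted term is cut off and only the one
    with [A e] survives. *)
Lemma T_truncated p q e (A h : nat -> rat) :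
  iter q.+1 nabla A = delta 0 ->
  iter p nabla h = (fun j => if (j <= e)%N then A j else 0) ->
  T (p + q) h = fun j => (q + e).+1%:R * A e * iter p psum (delta e) j.
Proof.
move=> HA Hh.
have TA := T_eq0 HA.
have E : iter p nabla (T (p + q) h) =
         fun j => (q + e).+1%:R * A e * delta e j.
  rewrite iter_nabla_T Hh; apply/funext=> j; have := TA j.
  rewrite /T /delta !addn1; case: (ltngtP j e) => [je|je|->] Tj.
  - by rewrite Tj /=; ring.
  - by rewrite /=; ring.
  - by rewrite /=; ring.
rewrite -[LHS](iter_nablaK p) E.
elim: p {E Hh} => // p IH; rewrite iterS IH; apply/funext=> j.
by rewrite iterS /psum -mulr_sumr.
Qed.

(** * The closed convex hull *)

Lemma continuous_linear_form (R : numFieldType) m (w : 'I_m -> R) :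
  continuous (fun b : 'rV[R^o]_m => \sum_(i < m) w i *: (b 0 i : R^o)).
Proof.
elim: (index_enum _) => [|i r IH].
  rewrite (_ : (fun b => _) = cst 0); first exact: cst_continuous.
  by apply/funext => b; rewrite big_nil.
rewrite (_ : (fun b => _) = w i \*: (fun b : 'rV[R^o]_m => b 0 i : R^o) \+
    (fun b : 'rV[R^o]_m => \sum_(i <- r) w i *: (b 0 i : R^o))).
  move=> b; have Fb : Filter (nbhs b) by exact: nbhs_filter.
  apply: (@cvgD _ _ _ (nbhs b) Fb); last exact: IH.
  apply: (@cvgZl_tmp _ _ _ (nbhs b) Fb); exact: coord_continuous.
by apply/funext => b; rewrite big_cons.
Qed.

Lemma VP n a h : V n a h <->
  forall j, (`|(a + n%:Z)%R|%N < j)%N -> iter n nabla h j = 0.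
Proof.
set m := `|_|%N; split=> [[b [sb hb]] j mj|H].
  by rewrite -numeratorE hb nth_default// (leq_trans sb).
exists (\poly_(j < m.+1) numerator n h j); split=> [|j]; first exact: size_poly.
rewrite coef_poly ltnS; case: leqP => // mj.
by rewrite numeratorE H.
Qed.

(** The [n]-th difference of [T n h] is [T 0] of that of [h], which at [j] involves only the values
    at [j] and [j + 1]. *)
Lemma V_T n a h : V n a h -> V n a (T n h).
Proof.
move=> /VP H; apply/VP => j mj; have := iter_nabla_T n 0 h; rewrite addn0 => ->.
by rewrite T0E !H// ?subrr ?mulr0// ltnW.
Qed.

Lemma V_comb n a (c d : rat) f g :
  V n a f -> V n a g -> V n a (fun j => c * f j + d * g j).
Proof.
move=> /VP Hf /VP Hg; apply/VP => j mj.
by rewrite iter_nabla_comb Hf// Hg// !mulr0 addr0.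
Qed.

Definition comb_morph (F : (nat -> rat) -> nat -> rat) := forall (c d : rat) f g,
  F (fun j => c * f j + d * g j) = fun j => c * F f j + d * F g j.

Lemma comb_morph_sum F (I : Type) (r : seq I) (c : I -> rat) f : comb_morph F ->
  F (fun j => \sum_(i <- r) c i * f i j) = fun j => \sum_(i <- r) c i * F (f i) j.
Proof.
move=> HF; elim: r => [|i r IH].
  under eq_fun do rewrite big_nil; under [RHS]eq_fun do rewrite big_nil.
  have := HF 0 0 (fun=> 0) (fun=> 0); under eq_fun do rewrite !mul0r addr0.
  by move=> ->; apply/funext => j; rewrite !mul0r addr0.
have -> : (fun j => \sum_(i0 <- i :: r) c i0 * f i0 j) =
    fun j => c i * f i j + 1 * \sum_(i0 <- r) c i0 * f i0 j.
  by apply/funext => j; rewrite big_cons mul1r.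
by rewrite HF IH; apply/funext => j; rewrite big_cons mul1r.
Qed.

Lemma iter_psum_comb n : comb_morph (iter n psum).
Proof. by move=> c d f g; elim: n => // n IH; rewrite !iterS IH psum_comb. Qed.

(** In the coordinates of [V] each condition is a closed half-space, and the set is their
    intersection. The lemma serves for [T n] and for the identity. *)
Lemma halfspaces_closed_convex n a F : comb_morph F ->
  closed_convex_in_V n a [set h | V n a h /\ forall j, 0 <= F h j].
Proof.
move=> HF; split=> [h []//| |].
  move=> x y l /set_mem[Vx Fx] /set_mem[Vy Fy]; apply/mem_set.
  rewrite (_ : conv l x y =
    (fun j => l%:num * x j + (1 - l%:num) * y j)); last first.
    by apply/funext => j.
  split; first exact: V_comb.
  move=> j; rewrite HF; apply: addr_ge0; apply: mulr_ge0; rewrite ?Fx ?Fy ?ge0//.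
set m := `|(a + n%:Z)%R|%N.
pose s i := iter n psum (delta i).
(* [W] inverts [V_coord]: [n] prefix sums recover a function from its numerator. *)
pose W (b : 'rV[rat^o]_m.+1) : nat -> rat :=
  iter n psum (fun j => \sum_(i < m.+1) b 0 i * delta i j).
have HW b j : F (W b) j = \sum_(i < m.+1) b 0 i * F (s i) j.
  rewrite /W (comb_morph_sum _ (fun i => b 0 i)); last exact: iter_psum_comb.
  by rewrite (comb_morph_sum _ (fun i => b 0 i)).
have WK h : V n a h -> W (V_coord n a h) = h.
  move=> /VP Vh; rewrite -[RHS](iter_nablaK n); congr (iter n psum _).
  apply/funext => j; have [jm|mj] := ltnP j m.+1; last first.
    rewrite Vh// big1// => i _.
    by rewrite /delta gtn_eqF ?mulr0// (leq_trans (ltn_ord i)).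
  rewrite (bigD1 (Ordinal jm))//= big1 => [|i ij].
    by rewrite /delta eqxx mulr1 addr0 mxE numeratorE.
  rewrite /delta; case: eqP => [E|_]; last by rewrite mulr0.
  by case/eqP: ij; apply: val_inj.
have VW b : V n a (W b).
  apply/VP => j mj; rewrite /W iter_psumK big1// => i _.
  by rewrite /delta gtn_eqF ?mulr0// (leq_trans (ltn_ord i)).
have WE b : V_coord n a (W b) = b.
  apply/rowP => j; rewrite mxE numeratorE /W iter_psumK.
  rewrite (bigD1 j)//= big1 => [|i ij].
    by rewrite /delta eqxx mulr1 addr0.
  by rewrite /delta val_eqE eq_sym (negbTE ij) mulr0.
rewrite [X in closed X](_ : _ = \bigcap_j [set b : 'rV[rat^o]_m.+1 |
    [set x : rat^o | 0 <= x] (\sum_(i < m.+1) b 0 i * F (s i) j)]).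
  apply: closed_bigI => j _.
  have Wc : continuous (fun b : 'rV[rat^o]_m.+1 =>
      \sum_(i < m.+1) b 0 i * F (s i) j : rat^o).
    under eq_fun do under eq_bigr do rewrite mulrC.
    exact: continuous_linear_form.
  by apply: (preimage_closed _ (@closed_ge _ 0)) => b _; exact: Wc.
apply/seteqP; split=> [_ [h [Vh Fh] <-] j _ /=|b Hb].
  by rewrite -HW WK.
exists (W b); last exact: WE.
by split=> [|j]; [exact: VW|rewrite HW; exact: Hb].
Qed.

Lemma hull_subset n a A C : closed_convex_in_V n a C -> A `<=` C ->
  closed_convex_hull n a A `<=` C.
Proof. by move=> HC AC; apply: smallest_sub. Qed.

(** [h] is the convex combination of [N h] and 0 with weight [1 / N] on the former. *)
Lemma hull_scale n a A N h : closed_convex_hull n a A (fun=> 0) ->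
  (0 < N)%N -> closed_convex_hull n a A (fun j => N%:R * h j) ->
  closed_convex_hull n a A h.
Proof.
move=> A0 N0 Ah C [HC AC].
have C0 := A0 C (conj HC AC); have Ch := Ah C (conj HC AC).
have Nge1 : 0 <= N%:R^-1 :> rat by rewrite invr_ge0.
have Nle1 : N%:R^-1 <= 1 :> rat by rewrite invf_le1 ?ler1n ?ltr0n.
have [_ cvx _] := HC.
have p1 : (0 <= N%:R^-1 :> rat) && (N%:R^-1 <= 1 :> rat) by apply/andP.
have := cvx _ _ (Itv01 Nge1 Nle1) (mem_set Ch) (mem_set C0).
move=> /set_mem; congr C; apply/funext => j.
rewrite -[LHS]/(N%:R^-1 * (N%:R * h j) + (1 - N%:R^-1) * 0).
by rewrite mulr0 addr0 mulKf// pnatr_eq0 -lt0n.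
Qed.

(** * Counting monomials *)

Section Monomials.
Local Open Scope nat_scope.
Variable N : nat.
Implicit Types (m : multinom N) (P D : pred (multinom N)).

Definition monomials j : seq (multinom N) :=
  [seq val b | b <- enum {: bmultinom N j.+1} & mdeg (val b) == j].

Lemma mem_monomials j m : (m \in monomials j) = (mdeg m == j).
Proof.
apply/mapP/eqP => [[b]|<-].
  by rewrite mem_filter => /andP[/eqP dj _] ->.
exists (BMultinom (ltnSn (mdeg m))) => //.
by rewrite mem_filter /= eqxx mem_enum.
Qed.

Lemma monomials_uniq j : uniq (monomials j).
Proof. by rewrite map_inj_uniq; [rewrite filter_uniq// enum_uniq|exact: val_inj]. Qed.

Lemma monomials0 : monomials 0 = [:: @mnm0 N].
Proof.
apply: perm_small_eq => //; apply: uniq_perm; [exact: monomials_uniq|by []|].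
by move=> m; rewrite mem_monomials mdeg_eq0 inE.
Qed.

Lemma monomials_shift j (i : 'I_N) :
  perm_eq [seq m : multinom N <- monomials j.+1 | 0 < m i]
    [seq mnm_add m (mnm1 i) | m <- monomials j].
Proof.
apply: uniq_perm; first by rewrite filter_uniq ?monomials_uniq.
  by rewrite map_inj_uniq ?monomials_uniq//; exact: addIm.
move=> m; rewrite mem_filter mem_monomials; apply/andP/mapP => [[mi /eqP dm]|[m' + ->]].
  have lem : mnm_add (mnm_sub m (mnm1 i)) (mnm1 i) = m.
    by apply: submK; rewrite lep1mP -lt0n.
  exists (mnm_sub m (mnm1 i)) => //; rewrite mem_monomials.
  by have := congr1 (@mdeg _) lem; rewrite mdegD mdeg1 dm addn1 => -[->].
rewrite mem_monomials => /eqP dm'; rewrite mdegD mdeg1 dm' addn1; split=> //.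
by rewrite mnmDE mnm1E eqxx addn1.
Qed.

Lemma count_monomials_shift j i P :
  count (fun m => P m && (0 < m i)) (monomials j.+1) =
  count (fun m => P (mnm_add m (mnm1 i))) (monomials j).
Proof.
rewrite -[LHS](count_filter P) (permP (monomials_shift j i)).
by rewrite count_map.
Qed.

(* Count the pairs of a monomial m of degree j.+1 in P and a unit of its
   exponent: those of the i-th exponent come from m / x_i, which is in P. *)
Lemma leq_count_monomials P j :
  (forall m i, P (mnm_add m (mnm1 i)) -> P m) ->
  j.+1 * count P (monomials j.+1) <= (N + j) * count P (monomials j).
Proof.
move=> HP.
have E (c : nat) k (F : multinom N -> nat) :
    (forall m, mdeg m = k -> F m = c) ->
    c * count P (monomials k) = \sum_(m <- monomials k | P m) F m.
  move=> HF; rewrite big_seq_cond (eq_bigr (fun=> c)).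
    by rewrite -big_seq_cond big_const_seq iter_addn_0.
  by move=> m /andP[]; rewrite mem_monomials => /eqP /HF.
rewrite (E j.+1 j.+1 (fun m => \sum_i m i)); last by move=> m; rewrite mdegE.
rewrite (E (N + j) j (fun m => \sum_i (m i).+1)); last first.
  move=> m dm; rewrite -dm mdegE -[X in X + _]card_ord -sum1_card -big_split/=.
  by apply: eq_bigr.
rewrite exchange_big [X in _ <= X]exchange_big /=; apply: leq_sum => i _.
rewrite (bigID (fun m => 0 < m i)) /= [X in _ + X]big1 ?addn0; last first.
  by move=> m /andP[_]; rewrite lt0n negbK => /eqP.
under eq_bigl do rewrite andbC.
rewrite -big_filter_cond (perm_big _ (monomials_shift j i)) /= big_map.
under eq_bigr do rewrite mnmDE mnm1E eqxx addn1.
rewrite big_mkcond [X in _ <= X]big_mkcond /=; apply: leq_sum => m _.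
by case: ifP => // /HP ->.
Qed.

Definition monomial_count P (j : nat) : rat := (count P (monomials j))%:R%R.

Definition in_first s m := [forall l : 'I_N, (s <= l) ==> (m l == 0)].

(** Multiplication by the variable of index [s] maps the counted monomials of degree [j] bijectively
    onto those of degree [j + 1] that it divides, so the difference counts those that avoid it. *)
Lemma nabla_monomial_count D s (sN : s < N) :
  (forall m, D (mnm_add m (mnm1 (Ordinal sN))) = D m) ->
  nabla (monomial_count (fun m => D m && in_first s.+1 m)) =
  monomial_count (fun m => D m && in_first s m).
Proof.
set i := Ordinal sN => HD.
have E m : in_first s m = in_first s.+1 m && (m i == 0).
  apply/forallP/andP => [H|[/forallP H mi] l].
    split; last by have /implyP := H i; apply.
    by apply/forallP => l; apply/implyP => /ltnW sl; have /implyP := H l; apply.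
  apply/implyP; rewrite leq_eqVlt => /orP[/eqP sl|sl].
    by rewrite (_ : l = i)//; apply: val_inj.
  by have /implyP := H l; apply.
have S m : in_first s.+1 (mnm_add m (mnm1 i)) = in_first s.+1 m.
  apply: eq_forallb => l; case: (ltnP s l) => //= sl.
  by rewrite mnmDE mnm1E -val_eqE /= (ltn_eqF sl) addn0.
apply/funext => -[|j]; rewrite /nabla /monomial_count.
  rewrite subr0 monomials0 /= E; congr (_%:R)%R.
  by rewrite mnm0E eqxx andbT.
apply/eqP; rewrite subr_eq -natrD eqr_nat; apply/eqP.
rewrite -size_filter -(count_predC (fun m => m i == 0)) !count_filter.
congr (_ + _).
  by apply: eq_count => m /=; rewrite E andbC andbA.
rewrite -[in RHS](eq_count (a1 := fun m => D (mnm_add m (mnm1 i)) &&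
  in_first s.+1 (mnm_add m (mnm1 i)))); last by move=> m; rewrite /= HD S.
rewrite -(count_monomials_shift j i (fun m => D m && in_first s.+1 m)).
by apply: eq_count => m /=; rewrite andbC lt0n.
Qed.

Lemma iter_nabla_monomial_count D q p s :
  (forall m (i : 'I_N), q <= i -> D (mnm_add m (mnm1 i)) = D m) ->
  q <= s -> s + p <= N ->
  iter p nabla (monomial_count (fun m => D m && in_first (s + p) m)) =
  monomial_count (fun m => D m && in_first s m).
Proof.
move=> HD qs; elim: p => [|p IH]; first by rewrite addn0.
rewrite addnS => spN; rewrite iterSr (@nabla_monomial_count _ _ spN); first exact/IH/ltnW.
by move=> m; apply: HD; rewrite (leq_trans qs)// leq_addr.
Qed.

Definition nvar_count q : nat -> rat := monomial_count (fun m => in_first q m).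

(** Each difference removes one variable; with none left, only the monomial 1 counts. *)
Lemma iter_nabla_nvar_count q : q <= N -> iter q nabla (nvar_count q) = delta 0.
Proof.
move=> qN; have := @iter_nabla_monomial_count predT 0 q 0 _ (leqnn _) qN.
rewrite add0n => ->//; apply/funext => j; rewrite /monomial_count /delta.
have E : (fun m => predT m && in_first 0 m) =1 pred1 (@mnm0 N).
  move=> m; apply/forallP/eqP => [H|-> l]; last by rewrite mnm0E eqxx.
  by apply/mnmP => l; rewrite mnm0E; apply/eqP; exact: H.
by rewrite (eq_count E) count_uniq_mem ?monomials_uniq// mem_monomials mdeg0 eq_sym.
Qed.

Lemma nvar_count_gt0 q e : 0 < q -> 0 < N -> (0 < nvar_count q e)%R.
Proof.
move=> q0 N0; rewrite ltr0n -has_count; apply/hasP.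
exists (mnm_muln (mnm1 (Ordinal N0)) e).
  by rewrite mem_monomials mdegMn mdeg1 mul1n.
apply/forallP => l; apply/implyP => ql; rewrite mulmnE mnm1E -val_eqE /=.
by rewrite (ltn_eqF (leq_trans q0 ql)).
Qed.

(* The monomials outside the ideal (x_0, ..., x_(q-1))^e. *)
Definition power_std q e m := \sum_(l < N | l < q) m l < e.

Lemma power_std_ge q e m (i : 'I_N) : q <= i ->
  power_std q e (mnm_add m (mnm1 i)) = power_std q e m.
Proof.
move=> qi; rewrite /power_std; congr (_ < _); apply: eq_bigr => l lq.
by rewrite mnmDE mnm1E -val_eqE (gtn_eqF (leq_trans lq qi)) addn0.
Qed.

(** The differences remove the [p] variables that do not generate the ideal. A monomial in the other
    [q] is outside the power exactly when its degree is less than [e]. *)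
Lemma iter_nabla_power_std p q e : q + p = N ->
  iter p nabla (monomial_count (power_std q e)) =
  fun j => if j < e then nvar_count q j else 0%R.
Proof.
move=> qpN.
have -> : monomial_count (power_std q e) =
    monomial_count (fun m => power_std q e m && in_first (q + p) m).
  apply/funext => j; congr (_%:R)%R; apply: eq_count => m.
  suff -> : in_first (q + p) m by rewrite andbT.
  by rewrite qpN; apply/forallP => l; rewrite leqNgt ltn_ord.
rewrite (@iter_nabla_monomial_count _ q) ?qpN//; last by move=> m i; exact: power_std_ge.
apply/funext => j; rewrite /monomial_count.
rewrite (@eq_in_count _ _ (fun m => (j < e) && in_first q m)) => [|m].
  by case: (j < e); rewrite //= count_pred0.
rewrite mem_monomials => /eqP <-; case: (boolP (in_first q m)); rewrite ?andbF// !andbT.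
move=> /forallP H; rewrite /power_std mdegE.
rewrite [X in _ = (X < e)](bigID (fun l : 'I_N => l < q)) /=.
rewrite [X in _ = (_ + X < e)]big1 ?addn0// => l; rewrite -leqNgt => ql.
by apply/eqP; have /implyP := H l; apply.
Qed.

End Monomials.

Lemma T_power_std n p q e : (q + p = n)%N ->
  T n (monomial_count (power_std (N := n.+1) q.+1 e.+1)) =
  fun j => (q + e).+1%:R * nvar_count n.+1 q.+1 e * iter p psum (delta e) j.
Proof.
move=> <-; rewrite [in T _]addnC; apply: T_truncated.
  by apply: iter_nabla_nvar_count; rewrite ltnS leq_addr.
rewrite iter_nabla_power_std; last by rewrite addSn.
by apply/funext => j; rewrite ltnS.
Qed.

Lemma eventually_zero_iter_nabla n h :
  eventually_zero h -> eventually_zero (iter n nabla h).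
Proof. by move=> H; elim: n => // n; exact: eventually_zero_nabla. Qed.

Lemma eventually_zero_power_std n p q e : (q + p = n)%N ->
  eventually_zero (iter n nabla (monomial_count (power_std (N := n.+1) q.+1 e))).
Proof.
move=> qpn; rewrite -qpn iterD; apply: eventually_zero_iter_nabla.
rewrite qpn iter_nabla_power_std ?addSn ?qpn//.
by exists e => j ej; rewrite ltnNge ej.
Qed.

(** * Growth of Hilbert functions *)

Lemma dim_span_rcons (K : fieldType) (vT : vectType K) (X : seq vT) v :
  \dim <<rcons X v>> = (\dim <<X>> + (v \notin <<X>>%VS))%N.
Proof.
rewrite -cats1 span_cat span_seq1; have [vX|vX] /= := boolP (v \in _).
  by rewrite addn0 (addv_idPl _) // -memvE.
have v0 : v != 0 by apply: contraNneq vX => ->; rewrite mem0v.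
rewrite dimv_disjoint_sum ?dim_vline ?v0//.
apply/eqP; rewrite -subv0; apply/subvP => x /memv_capP[xX /vlineP[c xc]].
have [c0|c0] := eqVneq c 0; first by rewrite xc c0 scale0r mem0v.
by case/negP: vX; rewrite -[v](scalerK c0) memvZ// -xc.
Qed.

(** The vectors outside the span of the smaller ones form a basis of the whole span. Once [s] is
    sorted, its last term raises the dimension exactly when it is counted. *)
Lemma greedy_dim (K : fieldType) (vT : vectType K) (disp : Order.disp_t)
    (I : orderType disp) (s : seq I) (v : I -> vT) : uniq s ->
  count (fun t => v t \notin <<[seq v u | u <- s & (u < t)%O]>>%VS) s =
  \dim <<map v s>>.
Proof.
have E (s1 s2 : seq I) : s1 =i s2 -> <<map v s1>>%VS = <<map v s2>>%VS.
  move=> H; apply: eq_span => x; apply/mapP/mapP => -[u us ->].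
    by exists u; rewrite -?H.
  by exists u; rewrite ?H.
move=> us; have ps := permEl (perm_sort <=%O s).
rewrite -(E _ _ (perm_mem ps)) -(permP ps).
rewrite (@eq_count _ _ (fun t => v t \notin
    <<[seq v u | u <- sort <=%O s & (u < t)%O]>>%VS)); last first.
  move=> t; rewrite (E _ [seq u <- sort <=%O s | (u < t)%O])// => u.
  by rewrite !mem_filter (perm_mem ps).
have : pairwise <%O (sort <=%O s) by rewrite -lt_sorted_pairwise sort_lt_sorted.
move: (sort _ s) => {us ps}s.
elim/last_ind: s => [|s t IH] /=; first by rewrite span_nil dimv0.
rewrite pairwise_rcons => /andP[/allP st sp].
rewrite map_rcons dim_span_rcons -IH// -cats1 count_cat /= addn0; congr (_ + _)%N.
  apply: eq_in_count => u /st ut /=.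
  by rewrite filter_cat /= ltNge (ltW ut) cats0.
rewrite filter_cat /= ltxx cats0 (E _ s)// => u.
by rewrite mem_filter andb_idl// => /st.
Qed.

Section Macaulay.
Variables (k : fieldType) (n : nat) (M : graded_module k n).

(** [M] is a module over the polynomial ring only, so elements of [k] act as constant
    polynomials. *)
Definition kscale (c : k) (x : M) : M := mpolyC n.+1 c *: x.

Definition ksubspace (W : set M) := [/\ W 0,
  forall x y, W x -> W y -> W (x + y) & forall c x, W x -> W (kscale c x)].

Lemma ksubspace_sum W (I : Type) (r : seq I) (P : pred I) F : ksubspace W ->
  (forall i, P i -> W (F i)) -> W (\sum_(i <- r | P i) F i).
Proof. by move=> [W0 WD _] WF; apply: big_ind. Qed.

Lemma gm_pieceN j (x : M) : gm_piece M j x -> gm_piece M j (- x).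
Proof. by move=> px; rewrite -sub0r; apply: gm_pieceB => //; apply: gm_piece0. Qed.

Lemma ksubspace_piece j : ksubspace (gm_piece M j).
Proof.
split=> [|x y px py|c x]; first exact: gm_piece0.
  by rewrite -[y]opprK; apply: gm_pieceB => //; apply: gm_pieceN.
apply: (gm_pieceZ (i := 0%N)).
apply/dhomogP => m; rewrite msuppC; case: eqP => // _.
by rewrite inE => /eqP->; rewrite /= mdeg0.
Qed.

Hypothesis gen0 : generated_in_degree_zero M.
Variables (r : nat) (e : 'I_r -> M).
Hypothesis e0 : forall l, gm_piece M 0 (e l).
Hypothesis espan : forall x, gm_piece M 0 x ->
  exists c : 'I_r -> k, x = \sum_l kscale (c l) (e l).

Definition mon (t : multinom n.+1 *l 'I_r) : M := mpolyX k t.1 *: e t.2.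

(** Cutting the coefficients down to degree [j] yields the component of [x] of degree [j], which is
    [x] itself since the sum of the pieces is direct. *)
Lemma piece_decomp j x : gm_piece M j x ->
  exists (q : nat) (c : 'I_q -> polyS k n) (g : 'I_q -> M),
  (forall i, gm_piece M 0 (g i)) /\ x = \sum_i pihomog mdeg j (c i) *: g i.
Proof.
move=> px; have [q [c [g [g0 xE]]]] := gen0 x.
exists q, c, g; split=> //.
pose f d := \sum_i pihomog mdeg d (c i) *: g i.
have fp d : gm_piece M d (f d).
  apply: ksubspace_sum => [|i _]; first exact: ksubspace_piece.
  by rewrite -[d in gm_piece M d]addn0; apply: gm_pieceZ; [exact: pihomogP|].
pose D := ((\max_i mmeasure mdeg (c i)) + j.+1)%N.
have xf : x = \sum_(d < D) f d.
  rewrite exchange_big xE; apply: eq_bigr => i _; rewrite -scaler_suml.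
  rewrite -pihomog_partitionE//.
  by apply: leq_trans (leq_addr _ _); apply: leq_bigmax.
have jD : (j < D)%N by rewrite /D addnS ltnS leq_addl.
(* Subtracting [x] in degree [j] makes the total 0, so that [gm_direct] applies. *)
pose f' d := if d == j then f d - x else f d.
have := @gm_direct _ _ M D f' _ _ j jD; rewrite /f' eqxx => fj.
apply/esym/eqP; rewrite -subr_eq0; apply/eqP/fj.
  by move=> d; case: eqP => [->|//]; apply: gm_pieceB.
rewrite (bigD1 (Ordinal jD))//= eqxx (eq_bigr (fun d : 'I_D => f d)); last first.
  by move=> d; rewrite -val_eqE /= => /negbTE ->.
by rewrite addrAC [X in X - _](_ : _ = x) ?subrr// [in RHS]xf [RHS](bigD1 (Ordinal jD)).
Qed.

Lemma piece_span j W : ksubspace W ->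
  (forall t, mdeg t.1 = j -> W (mon t)) -> forall x, gm_piece M j x -> W x.
Proof.
move=> HW Wm x /piece_decomp[q [c [g [g0 ->]]]]; have [W0 WD WZ] := HW.
apply: ksubspace_sum => // i _; have [a ->] := espan (g0 i).
rewrite [pihomog _ _ _]mpolyE scaler_suml big_seq; apply: ksubspace_sum => // m.
move=> /(dhomogP _ _ _ (pihomogP _ _ _)) dm.
rewrite -mul_mpolyC -scalerA; apply: (WZ).
rewrite scaler_sumr; apply: ksubspace_sum => // l _.
by rewrite /kscale scalerA mulrC -scalerA; apply: WZ; apply: (Wm (m, l)).
Qed.

(** [mon t] is not a combination of smaller monomials of its degree. A separating subspace [W]
    expresses this without a notion of span in [M]. *)
Definition standard (t : multinom n.+1 *l 'I_r) : Prop :=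
  exists2 W, ksubspace W /\
    forall u : multinom n.+1 *l 'I_r, mdeg u.1 = mdeg t.1 -> (u < t)%O -> W (mon u)
  & ~ W (mon t).

(** The subspace is pulled back along multiplication by a variable, which is linear, raises degrees
    by one and preserves the strict monomial order. *)
Lemma standard_factor m i l :
  standard (mnm_add m (mnm1 i), l) -> standard (m, l).
Proof.
move=> [W [[W0 WD WZ] Wlt] Wt].
exists [set y | W (mpolyX k (mnm1 i) *: y)].
  split=> [|u um ut /=].
    split=> /= [|x y Wx Wy|c x Wx]; first by rewrite scaler0.
      by rewrite scalerDr; apply: WD.
    by rewrite /kscale scalerA mulrC -scalerA; apply: WZ.
  rewrite /mon scalerA -mpolyXD addmC.
  apply: (Wlt (mnm_add u.1 (mnm1 i), u.2)); first by rewrite /= !mdegD um.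
  by move: ut; rewrite !ltEprodlexi /= !lemc_add2l.
by rewrite /= /mon scalerA -mpolyXD addmC.
Qed.

Definition mon_pairs j : seq (multinom n.+1 *l 'I_r) :=
  [seq (m, l) | m <- monomials n.+1 j, l <- enum 'I_r].

Lemma mem_mon_pairs j t : (t \in mon_pairs j) = (mdeg t.1 == j).
Proof.
case: t => m l; apply/allpairsP/eqP => [[[m' l'] /= [m'j _ [-> _]]]|mj].
  by apply/eqP; rewrite -mem_monomials.
by exists (m, l); rewrite /= mem_monomials mj eqxx mem_enum.
Qed.

(** A basis identifies the piece with row vectors of length [d], where the standard monomials are
    those counted by [greedy_dim]; as monomials span the piece, the count is [d]. *)
Lemma count_standard j d : has_dim (gm_piece M j) d ->
  count (fun t => `[< standard t >]) (mon_pairs j) = d.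
Proof.
move=> [b [pb bu]].
pose phi (u : 'rV[k]_d) : M := \sum_i kscale (u 0 i) (b i).
have phiD u v : phi (u + v) = phi u + phi v.
  rewrite /phi -big_split /=; apply: eq_bigr => i _.
  by rewrite /kscale mxE mpolyCD scalerDl.
have phiZ c u : phi (c *: u) = kscale c (phi u).
  rewrite /phi /kscale scaler_sumr; apply: eq_bigr => i _.
  by rewrite mxE mpolyCM scalerA.
have phi_piece u : gm_piece M j (phi u).
  apply: ksubspace_sum => [|i _]; first exact: ksubspace_piece.
  by have [_ _ WZ] := ksubspace_piece j; apply: WZ.
have phi_inj : injective phi.
  move=> u v uv; have [c [_ cu]] := bu _ (phi_piece u).
  have Eu (w : 'rV[k]_d) : phi w = phi u -> c = [ffun i => w 0 i].
    move=> wu; apply: cu; rewrite -wu; apply: eq_bigr => i _.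
    by rewrite ffunE.
  apply/rowP => i; have := Eu u erefl; rewrite (Eu v (esym uv)).
  by move=> /ffunP/(_ i); rewrite !ffunE.
have phi_surj x : gm_piece M j x -> exists u, phi u = x.
  move=> /bu[c [-> _]]; exists (\row_i c i); apply: eq_bigr => i _.
  by rewrite mxE.
(* [v t] holds the coordinates of [mon t]; outside degree [j] its value is arbitrary. *)
have /boolp.choice[v Hv] : forall t : multinom n.+1 *l 'I_r,
    exists u, mdeg t.1 = j -> phi u = mon t.
  move=> t; have [tj|tj] := eqVneq (mdeg t.1) j; last first.
    by exists 0 => E; rewrite E eqxx in tj.
  have [|u Hu] := phi_surj (mon t); last by exists u.
  rewrite /mon -[j]addn0; apply: gm_pieceZ => //.
  by rewrite dhomogX; apply/eqP.
have spanW (U : {vspace 'rV[k]_d}) : ksubspace [set phi u | u in [set u | u \in U]].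
  split=> [|_ _ [u /= uU <-] [w /= wU <-]|c _ [u /= uU <-]].
  - exists 0; rewrite /= ?mem0v// /phi big1// => i _.
    by rewrite /kscale mxE mpolyC0 scale0r.
  - by exists (u + w); rewrite //= memvD.
  - by exists (c *: u); rewrite //= memvZ.
have inW W (X : seq 'rV[k]_d) : ksubspace W ->
    (forall u, u \in X -> W (phi u)) -> forall u, u \in <<X>>%VS -> W (phi u).
  move=> HW; have [W0 WD WZ] := HW.
  elim: X => [|x X IH] WX u.
    rewrite span_nil memv0 => /eqP ->; rewrite /phi big1// => i _.
    by rewrite /kscale mxE mpolyC0 scale0r.
  rewrite span_cons => /memv_addP[y /vlineP[c ->] [z zX ->]].
  rewrite phiD phiZ; apply: WD; first by apply/WZ/WX; rewrite mem_head.
  by apply: IH => // w wX; apply: WX; rewrite in_cons wX orbT.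
have full : <<map v (mon_pairs j)>>%VS = fullv.
  apply/eqP; rewrite eqEsubv subvf; apply/subvP => u _.
  have Wm t : mdeg t.1 = j ->
      [set phi w | w in [set w | w \in <<map v (mon_pairs j)>>%VS]] (mon t).
    move=> tj; exists (v t); last exact: Hv.
    by apply/memv_span/map_f; rewrite mem_mon_pairs tj.
  by have [w /= wU /phi_inj <-] := piece_span (spanW _) Wm (phi_piece u).
have upairs : uniq (mon_pairs j).
  apply: allpairs_uniq; rewrite ?monomials_uniq ?enum_uniq//.
  by move=> [m l] [m' l'] _ _ [-> ->].
have := @greedy_dim _ _ _ (multinom n.+1 *l 'I_r)%type (mon_pairs j) v upairs.
rewrite full dimvf dim_matrix mul1r => <-.
apply: eq_in_count => t; rewrite mem_mon_pairs => /eqP tj.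
apply/asboolP/idP => [[W [HW Wlt] Wt]|vt].
  apply/negP => vt; apply: Wt; rewrite -Hv//; apply: inW vt => // _ /mapP[u + ->].
  rewrite mem_filter mem_mon_pairs => /andP[ut /eqP uj].
  by rewrite Hv//; apply: Wlt => //; rewrite uj.
exists [set phi u | u in
  [set u | u \in <<[seq v u | u <- mon_pairs j & (u < t)%O]>>%VS]].
  split=> // u ut lt; exists (v u); last by apply: Hv; rewrite ut.
  by apply/memv_span/map_f; rewrite mem_filter lt mem_mon_pairs ut tj /=.
by move=> [w /= wU]; rewrite -Hv// => /phi_inj wv; rewrite -wv wU in vt.
Qed.

(** For each [l] the standard monomials are closed under division, so [leq_count_monomials] bounds
    their number; the bounds are summed over [l]. *)
Lemma hilbert_growth j d d' :
  has_dim (gm_piece M j) d -> has_dim (gm_piece M j.+1) d' ->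
  (j.+1 * d' <= (n.+1 + j) * d)%N.
Proof.
have E i : count (fun t => `[< standard t >]) (mon_pairs i) =
    (\sum_l count (fun m => `[< standard (m, l) >]) (monomials n.+1 i))%N.
  rewrite -sum1_count big_mkcond big_allpairs_dep /= exchange_big /= big_enum /=.
  by apply: eq_big => // l _; rewrite -sum1_count [RHS]big_mkcond.
move=> /count_standard <- /count_standard <-; rewrite !E !big_distrr /=.
apply: leq_sum => l _; apply: leq_count_monomials => m i /asboolP H.
by apply/asboolP; exact: standard_factor H.
Qed.

End Macaulay.

Lemma T_hilbert_ge0 (k : fieldType) n (M : graded_module k n) h :
  generated_in_degree_zero M -> is_hilbert_function M h ->
  forall j, 0 <= T n h j.
Proof.
move=> gen0 hM j; have [r [e [e0 eu]] _] := hM 0%N.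
have espan x : gm_piece M 0 x -> exists c : 'I_r -> k, x = \sum_l kscale (c l) (e l).
  by move=> /eu[c [-> _]]; exists c.
have [d Hd hd] := hM j; have [d' Hd' hd'] := hM j.+1.
rewrite /T !addn1 hd hd' -!natrM subr_ge0 ler_nat.
by have := hilbert_growth gen0 e0 espan Hd Hd'; rewrite addSn.
Qed.

(** * Torsion modules *)

Section Krull.
Variables (k : fieldType) (N : nat).
Local Notation R := (mpoly N k).
Implicit Types (P : {pred R}) (ys : seq R).

(* The exponents of the successive ys are the digits of t in base s. *)
Fixpoint digit_monomial s ys t : R :=
  if ys is y :: ys' then y ^+ (t %% s)%N * digit_monomial s ys' (t %/ s)%N else 1.

(** The value at [ys] of a polynomial of degree less than [s] in each variable, with coefficients
    numbered by base [s] digits. *)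
Definition digit_sum s ys (c : nat -> k) : R :=
  \sum_(t < s ^ size ys) mpolyC N (c t) * digit_monomial s ys t.

Lemma sum_digits (V : nmodType) s q (F : nat -> V) :
  \sum_(t < s * q) F t = \sum_(a < s) \sum_(b < q) F (a + s * b)%N.
Proof.
elim: q => [|q IH].
  by rewrite muln0 big_ord0 big1// => a _; rewrite big_ord0.
rewrite mulnS addnC big_split_ord /= IH -big_split /=; apply: eq_bigr => a _.
by rewrite big_ord_recr /= addnC.
Qed.

Lemma digit_sum_cons s y ys c : (0 < s)%N ->
  digit_sum s (y :: ys) c =
  \sum_(a < s) y ^+ a * digit_sum s ys (fun b => c (a + s * b)%N).
Proof.
move=> s0; rewrite /digit_sum [size _]/= expnS.
rewrite (sum_digits _ _ (fun t => mpolyC N (c t) * digit_monomial s (y :: ys) t)).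
apply: eq_bigr => a _.
rewrite mulr_sumr; apply: eq_bigr => b _ /=.
rewrite [(a + _)%N]addnC mulnC modnMDl divnMDl// modn_small// divn_small// addn0.
by rewrite mulrCA.
Qed.

Lemma ideal_cancel P u v : idealr_closed P -> u \in P -> u + v \in P -> v \in P.
Proof.
move=> [_ _ HP] uP uvP; rewrite (_ : v = -1 * u + (u + v)); first exact: HP.
by rewrite mulN1r addKr.
Qed.

Lemma ideal_mul P u v : idealr_closed P -> u \in P -> v * u \in P.
Proof. by move=> [P0 _ HP] uP; rewrite -[_ * _]addr0; apply: HP. Qed.

Lemma prime_ideal_mulX P y a u : idealr_closed P -> prime_idealr_closed P ->
  y \notin P -> y ^+ a * u \in P -> u \in P.
Proof.
move=> iP pP yP; elim: a => [|a IH]; first by rewrite mul1r.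
by rewrite exprS -mulrA => /pP; rewrite (negbTE yP).
Qed.

(* In a relation, factor out the lowest power of [head 0 ys]: its coefficient
   is a relation between the other ys modulo the next prime. *)
Lemma chain_digit_free s (P : nat -> {pred R}) ys c : (0 < s)%N ->
  (forall i, (i <= size ys)%N ->
     idealr_closed (P i) /\ prime_idealr_closed (P i)) ->
  (forall i, (i < size ys)%N -> {subset P i <= P i.+1}) ->
  (forall i, (i < size ys)%N ->
     nth 0 ys i \in P i.+1 /\ nth 0 ys i \notin P i) ->
  digit_sum s ys c \in P 0 -> forall t, (t < s ^ size ys)%N -> c t = 0.
Proof.
move=> s0; elim: ys P c => [|y ys IH] P c Pp Ps Py.
  have [iP _] := Pp 0%N isT; have [_ P1 _] := iP.
  rewrite /digit_sum big_ord1 mulr1 => c0P [|t]// _; apply/eqP.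
  apply: contraNT P1 => c0; rewrite -mpolyC1 -(mulVf c0) mpolyCM.
  exact: ideal_mul.
rewrite digit_sum_cons//; pose F a := digit_sum s ys (fun b => c (a + s * b)%N).
have [yP1 yP0] := Py 0%N isT.
have [iP0 pP0] := Pp 0%N isT; have [iP1 _] := Pp 1%N isT.
rewrite -[X in X \in _]/(\sum_(a < s) y ^+ a * F a) => HF.
suff H a : (a < s)%N -> forall b, (b < s ^ size ys)%N -> c (a + s * b)%N = 0.
  move=> t tlt; rewrite (divn_eq t s) addnC mulnC; apply: H; first exact: ltn_pmod.
  by rewrite ltn_divLR// -expnSr.
have [m] := ubnP a; elim: m a => // m IHm a; rewrite ltnS => am sa.
have {}HF : F a \in P 1%N.
  (* Terms below [a] vanish by induction, and those above are multiples of [y ^+ a.+1]. The factor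
     [y ^+ a] cancels as [y] is outside [P 0]; since [y] lies in [P 1], so does [F a]. *)
  have E : \sum_(i < s) y ^+ i * F i =
      y ^+ a * (y * (\sum_(i < s | (a < i)%N) y ^+ (i - a).-1 * F i) + F a).
    rewrite mulrDr mulrA -exprSr mulr_sumr (bigD1 (Ordinal sa))//= addrC.
    congr (_ + _); rewrite (bigID (fun i : 'I_s => (a < i)%N)) /=.
    rewrite [X in _ + X]big1 ?addr0; last first.
      move=> i /andP[ia]; rewrite -leqNgt leq_eqVlt.
      rewrite -val_eqE /= in ia; rewrite (negbTE ia) /= => ltia.
      rewrite /F /digit_sum big1 ?mulr0// => b _.
      by rewrite (IHm i) ?mpolyC0 ?mul0r//; apply: leq_trans am.
    apply: eq_big => [i|i /andP[_ ai]].
      by rewrite -val_eqE /=; case: ltngtP.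
    by rewrite mulrA -exprD; congr (_ ^+ _ * _); lia.
  move: HF; rewrite E => /(prime_ideal_mulX iP0 pP0 yP0) HF.
  apply: (ideal_cancel iP1 _ (Ps 0%N isT _ HF)).
  by rewrite mulrC; apply: ideal_mul.
apply: (IH (fun i => P i.+1)) HF => i ile.
- exact: (Pp i.+1).
- exact: (Ps i.+1).
- exact: (Py i.+1).
Qed.

(** * Algebraic dependence by counting monomials *)

Definition deg_le (d : nat) (p : R) := forall m, m \in msupp p -> (mdeg m <= d)%N.

Lemma deg_leM d e p q : deg_le d p -> deg_le e q -> deg_le (d + e)%N (p * q).
Proof.
move=> Hp Hq m /msuppM_le/allpairsP[[m1 m2] /= [m1p m2q ->]].
by rewrite mdegD leq_add ?Hp ?Hq.
Qed.

Lemma deg_le1 : deg_le 0 1.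
Proof. by move=> m; rewrite msupp1 inE => /eqP->; rewrite mdeg0. Qed.

Lemma deg_leX d p a : deg_le d p -> deg_le (d * a) (p ^+ a).
Proof.
move=> Hp; elim: a => [|a IH]; first by rewrite muln0; exact: deg_le1.
by rewrite exprS mulnS; apply: deg_leM.
Qed.

Lemma deg_leW d e p : (d <= e)%N -> deg_le d p -> deg_le e p.
Proof. by move=> de Hp m /Hp/leq_trans; apply. Qed.

Lemma deg_digit_monomial s d ys t : (0 < s)%N ->
  (forall y, y \in ys -> deg_le d y) ->
  deg_le (size ys * (d * s)) (digit_monomial s ys t).
Proof.
move=> s0; elim: ys t => [|y ys IH] t Hd /=; first exact: deg_le1.
rewrite mulSn; apply: deg_leM.
  have Hy := @deg_leX _ _ (t %% s)%N (Hd y (mem_head _ _)).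
  apply: (@deg_leW _ _ _ _ Hy).
  by rewrite leq_mul2l ltnW ?orbT// ltn_pmod.
by apply: IH => z zys; apply: Hd; rewrite in_cons zys orbT.
Qed.

Lemma card_bmultinom b : (#|{: bmultinom N b}| <= b ^ N)%N.
Proof.
have lt (m : bmultinom N b) i : (bmnm m i < b)%N.
  by apply: leq_ltn_trans (bmdeg m); rewrite mdegE (bigD1 i)//= leq_addr.
pose f (m : bmultinom N b) := [ffun i => Ordinal (lt m i)].
rewrite -[b in (b ^ _)%N]card_ord -[N in (_ ^ N)%N]card_ord -card_ffun.
apply: (@leq_card _ _ f) => m1 m2 /ffunP H; apply/val_inj/mnmP => i.
by have /(congr1 val) := H i; rewrite !ffunE.
Qed.

(** For large [s] there are more products of powers of the [ys] than monomials available to them, so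
    their coefficient matrix has a nonzero left kernel. *)
Lemma digit_dependence ys : (N < size ys)%N -> exists s (c : nat -> k),
  [/\ (0 < s)%N, digit_sum s ys c = 0
    & exists2 t, (t < s ^ size ys)%N & c t != 0].
Proof.
move=> Nys.
have [d Hd] : exists d, forall y, y \in ys -> deg_le d y.
  elim: (ys) => [|y l [d IH]]; first by exists 0%N.
  exists (d + mmeasure mdeg y)%N => z; rewrite in_cons => /orP[/eqP->|zl].
    by move=> m /msize_mdeg_lt/ltnW/leq_trans; apply; apply: leq_addl.
  exact: deg_leW (leq_addr _ _) (IH _ zl).
(* All products have degree below [b <= C * s], so at most [C ^ N * s ^ N] monomials are available;
   [s > C ^ N] makes this less than [s ^ N.+1]. *)
pose C := (size ys * d).+1; pose s := (C ^ N).+1; pose b := (size ys * (d * s)).+1.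
have lt_dim : (#|{: bmultinom N b}| < s ^ size ys)%N.
  apply: leq_ltn_trans (card_bmultinom b) _.
  apply: (@leq_ltn_trans ((C * s) ^ N)).
    case: (N) => // N'; rewrite leq_exp2r// /b /C mulSn mulnA -addn1 addnC.
    by rewrite leq_add2r.
  rewrite expnMn; apply: (@leq_trans (s ^ N.+1)); last by rewrite leq_pexp2l.
  by rewrite expnS ltn_pmul2r ?expn_gt0.
pose A := \matrix_(t < s ^ size ys, m < #|{: bmultinom N b}|)
  mcoeff (bmnm (enum_val m)) (digit_monomial s ys t).
have : kermx A != 0.
  rewrite kermx_eq0 /row_free; apply: contraTneq lt_dim => rA.
  by rewrite -leqNgt -rA rank_leq_col.
move=> /rowV0Pn[u /sub_kermxP uA u0].
have [i ui] : exists i, u 0 i != 0.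
  apply/existsP; apply: contraNT u0; rewrite negb_exists => /forallP H.
  by apply/eqP/rowP => i; rewrite mxE; apply/eqP; have := H i; rewrite negbK.
exists s, (fun t => if insub t is Some i then u 0 i else 0); split=> //; last first.
  by exists i => //; rewrite valK.
rewrite /digit_sum; apply/mpolyP => m; rewrite raddf_sum /= mcoeff0.
under eq_bigr do rewrite valK mcoeffCM.
have [mb|bm] := ltnP (mdeg m) b; last first.
  rewrite big1// => t _; rewrite [X in _ * X](_ : _ = 0) ?mulr0//.
  apply: memN_msupp_eq0; apply: contraL bm => /(deg_digit_monomial (d := d)) H.
  by rewrite -ltnNge ltnS; apply: H.
have := congr1 (fun B : 'rV_ _ => B 0 (enum_rank (BMultinom mb))) uA.
rewrite !mxE => E; rewrite -[RHS]E; apply: eq_bigr => t _.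
by rewrite mxE enum_rankK.
Qed.

End Krull.

(* The zero ideal and n+2 primes over f form a chain of n+3 primes; elements
   chosen in its n+2 gaps are algebraically independent over k. *)
Lemma krull_dim_lt_torsion (k : fieldType) n (M : graded_module k n) f :
  f != 0 -> annihilates M f -> krull_dim_lt M n.+1.
Proof.
move=> f0 Mf [P [PP Plt]].
have /boolp.choice[y Hy] : forall i, exists y, (i <= n)%N -> y \in P i.+1 /\ y \notin P i.
  move=> i; apply: contrapT => /forallNP H.
  have [le_in|lt] := leqP i n; last by apply: (H 0); rewrite leqNgt lt.
  have [_] := Plt i le_in; apply=> y yP; apply: contrapT => /negP yP'.
  by apply: (H y).
(* The zero ideal goes below the given chain; [f], nonzero and in the annihilator, lies in the first
   gap. *)
pose P' i : {pred polyS k n} := if i is i'.+1 then P i' else pred1 0.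
pose ys := f :: mkseq y n.+1.
have sys : size ys = n.+2 by rewrite /= size_map size_iota.
have nys i : (i <= n)%N -> nth 0 ys i.+1 = y i by move=> ile; exact: nth_mkseq.
have [|s [c [s0 Hc [t ts /eqP]]]] := @digit_dependence k n.+1 ys; first by rewrite sys.
apply; apply: (@chain_digit_free _ _ s P' ys c s0) ts; rewrite ?sys ?Hc ?inE//.
- case=> [_|i ile]; last by have [[]] := PP i ile.
  split; last by move=> u v; rewrite !inE mulf_eq0.
  split; rewrite ?inE ?oner_eq0// => a u v.
  by rewrite !inE => /eqP-> /eqP->; rewrite mulr0 addr0.
- case=> [_ u|i ile]; last by have [] := Plt i ile.
  by rewrite inE => /eqP->; have [[[]]] := PP 0%N isT.
- case=> [_|i ile]; last by rewrite nys//; apply: Hy.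
  by rewrite inE f0; split=> //; have [_] := PP 0%N isT; apply.
Qed.

(** * Quotients by monomial submodules *)

Section MonomialPart.
Variables (k : fieldType) (N : nat).
Implicit Types (P : pred (multinom N)) (p q : mpoly N k).

Definition monomial_part P p : mpoly N k :=
  \sum_(m <- msupp p | P m) mcoeff m p *: mpolyX k m.

Lemma mcoeff_part P p m : mcoeff m (monomial_part P p) = if P m then mcoeff m p else 0.
Proof.
rewrite raddf_sum /= big_mkcond /= (eq_bigr (fun u =>
    (if P m then mcoeff m p else 0) * (u == m)%:R)) => [|u _]; last first.
  rewrite mcoeffZ mcoeffX; case: eqP => [->|_]; last by rewrite !mulr0 if_same.
  by rewrite !mulr1.
rewrite -mulr_sumr; case: ifP => Pm; last by rewrite mul0r.
have [mp|mp] := boolP (m \in msupp p); last by rewrite (memN_msupp_eq0 mp) mul0r.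
rewrite (bigD1_seq m) ?msupp_uniq//= eqxx big1 ?addr0 ?mulr1// => u /negbTE ->.
by [].
Qed.

Lemma mcoeffM_eq p q q' m :
  (forall m1 m2, m = mnm_add m1 m2 -> mcoeff m2 q = mcoeff m2 q') ->
  mcoeff m (p * q) = mcoeff m (p * q').
Proof. by move=> H; rewrite !mcoeffM; apply: eq_bigr => -[m1 m2] /= /eqP/H ->. Qed.

End MonomialPart.

(** The complements of these sets are the monomials of a monomial submodule of the free module of
    rank [r]. *)
Record order_ideal (N r : nat) := OrderIdeal {
  oi_mem :> 'I_r -> pred (multinom N);
  oi_down : forall l m1 m2, oi_mem l (mnm_add m1 m2) -> oi_mem l m2 }.

Section MonomialModule.
Variables (k : fieldType) (n r : nat) (D : order_ideal n.+1 r).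
Local Notation F := {ffun 'I_r -> mpoly n.+1 k}.

Definition supported : {pred F} := fun f => [forall l, all (D l) (msupp (f l))].

Lemma supportedP (f : F) :
  reflect (forall l m, ~~ D l m -> mcoeff m (f l) = 0) (f \in supported).
Proof.
apply: (iffP forallP) => [H l m|H l].
  by apply: contraNeq; rewrite -mcoeff_msupp; apply: (allP (H l)).
by apply/allP => m; rewrite mcoeff_msupp; apply: contraNT => /H ->.
Qed.

Lemma supported_zmod_closed : zmod_closed supported.
Proof.
split=> [|f g /supportedP Hf /supportedP Hg]; apply/supportedP => l m Dm.
  by rewrite ffunE mcoeff0.
by rewrite !ffunE mcoeffB Hf// Hg// subr0.
Qed.

HB.instance Definition _ := GRing.isZmodClosed.Build F supported supported_zmod_closed.

(* The quotient of S^r by the monomial submodule complementary to D, each class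
   being represented by its element supported on D. *)
Record monomial_module := MonomialModule { mm_val :> F; _ : mm_val \in supported }.
HB.instance Definition _ := [isSub for mm_val].
HB.instance Definition _ := [Choice of monomial_module by <:].
HB.instance Definition _ := [SubChoice_isSubZmodule of monomial_module by <:].

Definition mm_coef (x : monomial_module) l m : k := mcoeff m (mm_val x l).

Lemma mm_of_subproof (g : 'I_r -> mpoly n.+1 k) :
  [ffun l => monomial_part (D l) (g l)] \in supported.
Proof. by apply/supportedP => l m Dm; rewrite ffunE mcoeff_part (negbTE Dm). Qed.

Definition mm_of g := MonomialModule (mm_of_subproof g).

Lemma mm_coef_of g l m : mm_coef (mm_of g) l m = if D l m then mcoeff m (g l) else 0.
Proof. by rewrite /mm_coef ffunE mcoeff_part. Qed.

Lemma mm_coef_out x l m : ~~ D l m -> mm_coef x l m = 0.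
Proof. by move=> Dm; apply: (supportedP _ (valP x)). Qed.

Lemma mm_ext x y : (forall l m, D l m -> mm_coef x l m = mm_coef y l m) -> x = y.
Proof.
move=> H; apply/val_inj/ffunP => l; apply/mpolyP => m.
have [Dm|Dm] := boolP (D l m); first exact: H.
exact: etrans (mm_coef_out x Dm) (esym (mm_coef_out y Dm)).
Qed.

Lemma mm_coefD x y l m : mm_coef (x + y) l m = mm_coef x l m + mm_coef y l m.
Proof. by rewrite /mm_coef [val _]raddfD ffunE mcoeffD. Qed.

Lemma mm_coefB x y l m : mm_coef (x - y) l m = mm_coef x l m - mm_coef y l m.
Proof. by rewrite /mm_coef [val _]raddfB !ffunE mcoeffB. Qed.

Lemma mm_coef0 l m : mm_coef 0 l m = 0.
Proof. by rewrite /mm_coef [val _]raddf0 ffunE mcoeff0. Qed.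

Lemma mm_coef_sum (I : Type) (s : seq I) (P : pred I) (x : I -> monomial_module) l m :
  mm_coef (\sum_(i <- s | P i) x i) l m = \sum_(i <- s | P i) mm_coef (x i) l m.
Proof.
apply: (big_morph (fun x => mm_coef x l m)); last exact: mm_coef0.
by move=> u v; exact: mm_coefD.
Qed.

Definition mm_scale (p : mpoly n.+1 k) (x : monomial_module) := mm_of (fun l => p * x l).

Lemma mm_coef_scale p x l m :
  mm_coef (mm_scale p x) l m = if D l m then mcoeff m (p * x l) else 0.
Proof. exact: mm_coef_of. Qed.

(** Truncating early changes nothing: the coefficient at [m] in [D l] depends only on divisors of
    [m], which are in [D l] too. *)
Lemma mm_scaleA p q x : mm_scale p (mm_scale q x) = mm_scale (p * q) x.
Proof.
apply: mm_ext => l m Dm; rewrite !mm_coef_scale Dm -mulrA.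
apply: mcoeffM_eq => m1 m2 mE; rewrite -[LHS]/(mm_coef _ l m2) mm_coef_scale.
by rewrite (oi_down (m1 := m1))// -mE.
Qed.

Lemma mm_scale1 : left_id 1 mm_scale.
Proof. by move=> x; apply: mm_ext => l m Dm; rewrite mm_coef_scale Dm mul1r. Qed.

Lemma mm_scaleDr : right_distributive mm_scale +%R.
Proof.
move=> p x y; apply: mm_ext => l m Dm.
by rewrite mm_coefD !mm_coef_scale Dm [val _]raddfD ffunE mulrDr mcoeffD.
Qed.

Lemma mm_scaleDl x : {morph mm_scale^~ x : p q / p + q}.
Proof.
move=> p q; apply: mm_ext => l m Dm.
by rewrite mm_coefD !mm_coef_scale Dm mulrDl mcoeffD.
Qed.

HB.instance Definition _ := GRing.Zmodule_isLmodule.Build (mpoly n.+1 k)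
  monomial_module mm_scaleA mm_scale1 mm_scaleDr mm_scaleDl.

Lemma mm_coefZ p (x : monomial_module) l m :
  mm_coef (p *: x) l m = if D l m then mcoeff m (p * x l) else 0.
Proof. exact: mm_coef_scale. Qed.

Definition mm_piece j : set monomial_module :=
  [set x | forall l m, mdeg m != j -> mm_coef x l m = 0].

Lemma mm_piece0 j : mm_piece j 0.
Proof. by move=> l m _; rewrite mm_coef0. Qed.

Lemma mm_pieceB j x y : mm_piece j x -> mm_piece j y -> mm_piece j (x - y).
Proof. by move=> Hx Hy l m mj; rewrite mm_coefB Hx// Hy// subr0. Qed.

Lemma mm_pieceZ i j p x :
  p \is ishomog1 i mdeg -> mm_piece j x -> mm_piece (i + j)%N (p *: x).
Proof.
move=> ph Hx l m mij; rewrite mm_coefZ; case: ifP => // _.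
rewrite mcoeffM big1// => -[m1 m2] /= /eqP mE.
have [m1i|m1i] := eqVneq (mdeg m1) i; last by rewrite (dhomog_nemf_coeff ph m1i) mul0r.
rewrite [X in _ * X](Hx l) ?mulr0//; apply: contraNneq mij => m2j.
by rewrite mE mdegD m1i m2j.
Qed.

Lemma mm_span x : exists (d : nat) (f : nat -> monomial_module),
  (forall j, mm_piece j (f j)) /\ x = \sum_(j < d) f j.
Proof.
exists (\max_l mmeasure mdeg (x l)).
exists (fun j => mm_of (fun l => monomial_part (fun m => mdeg m == j) (x l))).
split=> [j l m mj /=|]; first by rewrite mm_coef_of mcoeff_part (negbTE mj) if_same.
apply: mm_ext => l m Dm; rewrite mm_coef_sum.
rewrite (eq_bigr (fun j : 'I__ => if mdeg m == j then mcoeff m (x l) else 0));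
  last by move=> j _ /=; rewrite mm_coef_of Dm mcoeff_part.
have [mp|mp] := boolP (m \in msupp (x l)); last first.
  rewrite big1 => [|j _]; first exact: memN_msupp_eq0.
  by rewrite (memN_msupp_eq0 mp) if_same.
have md : (mdeg m < \max_l mmeasure mdeg (x l))%N.
  by apply: leq_trans (leq_bigmax l); apply: msize_mdeg_lt.
rewrite (bigD1 (Ordinal md))//= eqxx big1 ?addr0// => j.
by rewrite -val_eqE /= eq_sym => /negbTE ->.
Qed.

Lemma mm_direct d (f : nat -> monomial_module) :
  (forall j, mm_piece j (f j)) -> \sum_(j < d) f j = 0 ->
  forall j, (j < d)%N -> f j = 0.
Proof.
move=> fp sf j jd; apply: mm_ext => l m Dm; rewrite mm_coef0.
have [mj|mj] := eqVneq (mdeg m) j; last exact: fp.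
have := mm_coef_sum (index_enum 'I_d) predT (fun j : 'I_d => f j) l m.
rewrite sf mm_coef0 (bigD1 (Ordinal jd))//= big1 ?addr0// => i ij.
by rewrite fp// mj eq_sym; move: ij; rewrite -val_eqE.
Qed.

Definition mm_graded : graded_module k n :=
  GradedModule mm_piece0 mm_pieceB mm_pieceZ mm_span mm_direct.

Definition mm_gen (l0 : 'I_r) : mm_graded := mm_of (fun l => (l == l0)%:R).

Lemma mm_coefZ_of p g l m :
  mm_coef (p *: mm_of g) l m = if D l m then mcoeff m (p * g l) else 0.
Proof.
rewrite mm_coefZ; case: ifP => // Dm; apply: mcoeffM_eq => m1 m2 mE.
by rewrite -[LHS]/(mm_coef _ l m2) mm_coef_of (oi_down (m1 := m1))// -mE.
Qed.

Lemma mm_genE (x : mm_graded) : x = \sum_l (x : monomial_module) l *: mm_gen l.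
Proof.
apply: mm_ext => l m Dm; rewrite [RHS]mm_coef_sum (bigD1 l)//= big1 => [|l' l'l].
  by rewrite addr0 [RHS]mm_coefZ_of Dm eqxx mulr1.
by rewrite [LHS]mm_coefZ_of eq_sym (negbTE l'l) mulr0 mcoeff0 if_same.
Qed.

Lemma mm_finitely_generated : finitely_generated mm_graded.
Proof.
exists (range mm_gen); split; first exact: finite_image.
move=> x; exists r, (fun l => (x : monomial_module) l), mm_gen.
by split; [move=> l; exists l|exact: mm_genE].
Qed.

Lemma mm_generated_in_degree_zero : generated_in_degree_zero mm_graded.
Proof.
move=> x; exists r, (fun l => (x : monomial_module) l), mm_gen.
split=> [l l' m m0|]; last exact: mm_genE.
rewrite mm_coef_of -mpolyC_nat mcoeffC -mdeg_eq0 (negbTE m0) mulr0.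
by rewrite if_same.
Qed.

Lemma mm_annihilates m0 : (forall l m, ~~ D l (mnm_add m0 m)) ->
  annihilates mm_graded (mpolyX k m0).
Proof.
move=> Dm0 x; apply: mm_ext => l m Dm; rewrite mm_coef0 mm_coefZ Dm.
rewrite mcoeffM big1// => -[m1 m2] /= /eqP mE; rewrite mcoeffX.
case: eqP => [m01|]; last by rewrite mul0r.
by have /negP[] := Dm0 l m2; rewrite m01 -mE.
Qed.

Definition mm_basis j : seq ('I_r * multinom n.+1) :=
  [seq (l, m) | l <- enum 'I_r, m <- [seq m <- monomials n.+1 j | D l m]].

Lemma mem_mm_basis j l m : ((l, m) \in mm_basis j) = (mdeg m == j) && D l m.
Proof.
apply/allpairsPdep/andP => [[l' [m' [_ + [-> ->]]]]|[mj Dm]].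
  by rewrite mem_filter mem_monomials => /andP[-> ->].
by exists l, m; rewrite mem_enum mem_filter mem_monomials mj Dm.
Qed.

Lemma mm_basis_uniq j : uniq (mm_basis j).
Proof.
apply: allpairs_uniq_dep; first by rewrite enum_uniq.
  by move=> l _; rewrite filter_uniq ?monomials_uniq.
by move=> [l m] [l' m'] _ _ /= [-> ->].
Qed.

Lemma size_mm_basis j :
  size (mm_basis j) = (\sum_l count (D l) (monomials n.+1 j))%N.
Proof.
rewrite size_allpairs_dep sumnE big_map big_enum /=.
by apply: eq_bigr => l _; rewrite size_filter.
Qed.

(** The monomials of degree [j] in the order ideals form a basis, the coefficients at them being the
    coordinates. *)
Lemma mm_has_dim j : has_dim (gm_piece mm_graded j) (size (mm_basis j)).
Proof.
pose d := size (mm_basis j).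
have [t0 Ht0] : exists t : 'I_d -> 'I_r * multinom n.+1,
    forall i x, t i = nth x (mm_basis j) i.
  exists (fun i => tnth (in_tuple (mm_basis j)) i) => i x.
  by rewrite (tnth_nth x).
pose e (i : 'I_d) : monomial_module :=
  mm_of (fun l => if l == (t0 i).1 then mpolyX k (t0 i).2 else 0).
have tD i : mdeg (t0 i).2 = j /\ D (t0 i).1 (t0 i).2.
  have : t0 i \in mm_basis j by rewrite (Ht0 i (t0 i)) mem_nth.
  by case: (t0 i) => l m; rewrite mem_mm_basis => /andP[/eqP].
have ecoef i l m : D l m -> mm_coef (e i) l m = ((l, m) == t0 i)%:R.
  move=> Dm; rewrite mm_coef_of Dm; case: (t0 i) => l' m' /=.
  rewrite xpair_eqE; case: eqP => _; last by rewrite mcoeff0.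
  by rewrite mcoeffX eq_sym.
have tinj i i' : (t0 i == t0 i') = (i == i').
  by rewrite (Ht0 i (t0 i)) (Ht0 i' (t0 i)) nth_uniq ?mm_basis_uniq.
have sumcoef (c : 'I_d -> k) l m : D l m ->
    mm_coef (\sum_i mpolyC n.+1 (c i) *: e i : monomial_module) l m =
    \sum_i c i * ((l, m) == t0 i)%:R.
  move=> Dm; rewrite mm_coef_sum; apply: eq_bigr => i _.
  by rewrite mm_coefZ Dm mcoeffCM -ecoef.
have sumt (c : 'I_d -> k) i : \sum_i' c i' * (t0 i == t0 i')%:R = c i.
  rewrite (bigD1 i)//= eqxx mulr1 big1 ?addr0// => i' ii'.
  by rewrite tinj eq_sym (negbTE ii') mulr0.
exists e; split=> [i l m mj|x px].
  rewrite mm_coef_of; case: ifP => // _; case: ifP => _; last by rewrite mcoeff0.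
  rewrite mcoeffX; case: eqP => // mE; case/eqP: mj; rewrite -mE.
  by have [] := tD i.
exists [ffun i => mm_coef x (t0 i).1 (t0 i).2]; split=> [|c ->].
  apply: mm_ext => l m Dm; rewrite [RHS]sumcoef//.
  have [mj|mj] := eqVneq (mdeg m) j; last first.
    rewrite px// big1// => i _; case: eqP => [lm|_]; last by rewrite mulr0.
    by have [] := tD i; rewrite -lm /= => E; rewrite E eqxx in mj.
  have lmB : (l, m) \in mm_basis j by rewrite mem_mm_basis mj eqxx Dm.
  have id : (index (l, m) (mm_basis j) < d)%N by rewrite index_mem.
  have ti : (l, m) = t0 (Ordinal id) by rewrite (Ht0 _ (l, m)) nth_index.
  by rewrite ti sumt ffunE -ti.
apply/ffunP => i; rewrite ffunE sumcoef; last by have [] := tD i.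
by rewrite -surjective_pairing sumt.
Qed.

Lemma mm_hilbert_function :
  is_hilbert_function mm_graded (fun j => \sum_l monomial_count (D l) j).
Proof.
move=> j; exists (size (mm_basis j)); first exact: mm_has_dim.
by rewrite size_mm_basis natr_sum.
Qed.

End MonomialModule.

(** * Realization *)

Lemma T_comb n : comb_morph (T n).
Proof. by move=> c d f g; apply/funext => j; rewrite /T; ring. Qed.

(** The [n]-th difference has finitely many nonzero values, hence a common denominator, and prefix
    sums keep integrality. *)
Lemma clear_denominators n g : eventually_zero (iter n nabla g) ->
  exists2 N : nat, (0 < N)%N & forall j, N%:R * g j \is a Num.int.
Proof.
elim: n g => [|n IH] g.
  move=> [J HJ]; pose d i := `|denq (g i)|%N.
  have d0 i : (0 < d i)%N by rewrite absz_gt0 denq_neq0.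
  exists (\prod_(i < J) d i)%N; first by rewrite prodn_gt0.
  move=> j; have [jJ|/HJ/= ->] := ltnP j J; last by rewrite mulr0.
  rewrite (bigD1 (Ordinal jJ))//= natrM mulrAC rpredM ?natr_int//.
  rewrite mulrC -[X in X * _]divq_num_den /d natr_absz gtr0_norm ?denq_gt0//.
  by rewrite divfK ?intr_int// intr_eq0 denq_neq0.
rewrite iterSr => /IH[N N0 HN]; exists N => // j.
rewrite -[g]nablaK /psum mulr_sumr; apply: rpred_sum => i _; exact: HN.
Qed.

Lemma pos_in_hull n a g : V n a g -> (forall j, 0 <= g j) ->
  closed_convex_hull n a (nat_valued `&` V n a) g.
Proof.
move=> Vg g0; have V0 : V n a (fun=> 0).
  have := V_comb 0 0 Vg Vg; congr (V n a _); apply/funext => j.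
  by rewrite !mul0r addr0.
have [|N N0 HN] := @clear_denominators n g.
  by exists `|(a + n%:Z)%R|.+1 => j; apply: (VP n a g).1.
apply: (hull_scale (N := N)) => //.
  by move=> C [_ HC]; apply: HC; split=> // j; rewrite rpred0.
move=> C [_ HC]; apply: HC; split=> [j|].
  by rewrite natrEint HN mulr_ge0 ?ler0n.
have := V_comb N%:R 0 Vg Vg; congr (V n a _); apply/funext => j.
by rewrite mul0r addr0.
Qed.

Lemma power_std_down N q e (m1 m2 : multinom N) :
  power_std q e (mnm_add m1 m2) -> power_std q e m2.
Proof.
apply: leq_ltn_trans; apply: leq_sum => l _.
by rewrite mnmDE leq_addl.
Qed.

(** * Direct sums of quotients by powers of ideals of variables *)

Section Blocks.
Variables (k : fieldType) (n : nat).
Implicit Types bs : seq (nat * nat).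

(* The pair (q, e) stands for S / (x_0, ..., x_q)^(e+1). *)
Definition block_hilb (b : nat * nat) :=
  monomial_count (power_std (N := n.+1) b.1.+1 b.2.+1).
Definition sum_hilb bs : nat -> rat := fun j => \sum_(b <- bs) block_hilb b j.

Definition block_ideal bs : order_ideal n.+1 (size bs) :=
  @OrderIdeal n.+1 (size bs)
    (fun l => power_std (nth (0, 0) bs l).1.+1 (nth (0, 0) bs l).2.+1)%N
    (fun l => @power_std_down _ _ _).

Lemma sum_hilb_hilbert bs : hilbert_functions k n (sum_hilb bs).
Proof.
exists (mm_graded k (block_ideal bs)); split.
- exact: mm_finitely_generated.
- exact: mm_generated_in_degree_zero.
(* [E] is at least the exponent of every block, so [x_0 ^ E] lies in each of the ideals and kills
   the module. *)
- pose E := (\sum_(b <- bs) b.2.+1)%N.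
  apply: (@krull_dim_lt_torsion _ _ _ (mpolyX k (mnm_muln (mnm1 ord0) E))).
    by apply/eqP => /(congr1 (mcoeff (mnm_muln (mnm1 ord0) E)));
      rewrite mcoeffX eqxx mcoeff0 => /eqP; rewrite oner_eq0.
  apply: mm_annihilates => l m; rewrite /= -leqNgt (bigD1 ord0)//=.
  rewrite mnmDE mulmnE mnm1E eqxx mul1n -addnA; apply: leq_trans (leq_addr _ _).
  by rewrite /E (big_nth (0, 0)%N) big_mkord (bigD1 l)//= leq_addr.
- have := mm_hilbert_function k (block_ideal bs).
  congr (is_hilbert_function _ _); apply/funext => j.
  by rewrite /sum_hilb (big_nth (0, 0)%N) big_mkord.
Qed.

Lemma T_sum_hilb bs j : T n (sum_hilb bs) j = \sum_(b <- bs) T n (block_hilb b) j.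
Proof.
have := comb_morph_sum bs (fun=> 1) block_hilb (T_comb n).
rewrite (_ : (fun j => _) = sum_hilb bs).
  by move=> ->; apply: eq_bigr => b _; rewrite mul1r.
by apply/funext => i; apply: eq_bigr => b _; rewrite mul1r.
Qed.

(** Beyond the bound, [T 0] of the [n]-th difference vanishes, so this difference is constant there;
    being eventually zero, it is zero. *)
Lemma V_sum_hilb a bs : all (fun b => (b.1 <= n)%N) bs ->
  V n a (T n (sum_hilb bs)) -> V n a (sum_hilb bs).
Proof.
move=> Hbs VT; have [J HJ] : eventually_zero (iter n nabla (sum_hilb bs)).
  have nc : comb_morph (iter n nabla) by move=> ????; exact: iter_nabla_comb.
  have := comb_morph_sum bs (fun=> 1) block_hilb nc.
  rewrite (_ : (fun j => _) = sum_hilb bs); last first.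
    by apply/funext => i; apply: eq_bigr => b _; rewrite mul1r.
  move=> ->; elim: bs Hbs {VT} => [|b bs IH] /=.
    by exists 0%N => j _; rewrite big_nil.
  move=> /andP[bn /IH[J HJ]].
  have [J' HJ'] := @eventually_zero_power_std n (n - b.1) b.1 b.2.+1 (subnKC bn).
  exists (J + J')%N => j jJ; rewrite big_cons mul1r HJ ?HJ' ?addr0//.
    by apply: leq_trans jJ; apply: leq_addl.
  by apply: leq_trans jJ; apply: leq_addr.
have S j : (`|(a + n%:Z)%R|%N < j)%N ->
    iter n nabla (sum_hilb bs) j = iter n nabla (sum_hilb bs) j.+1.
  move=> /((VP _ _ _).1 VT); have := iter_nabla_T n 0 (sum_hilb bs).
  rewrite addn0 => -> /eqP; rewrite T0E mulf_eq0 pnatr_eq0 /= subr_eq0.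
  by move=> /eqP.
apply/VP => j mj.
have {}S i : iter n nabla (sum_hilb bs) (j + i)%N = iter n nabla (sum_hilb bs) j.
  elim: i => [|i IH]; first by rewrite addn0.
  by rewrite addnS -S// ltn_addr.
by rewrite -(S J) HJ// leq_addl.
Qed.

(** The factor [N] absorbs denominators: blocks have natural multiplicities, whereas the cone allows
    rational factors. *)
Definition realizable (g : nat -> rat) := exists (N : nat) bs,
  [/\ (0 < N)%N, all (fun b => (b.1 <= n)%N) bs
    & forall j, N%:R * g j = T n (sum_hilb bs) j].

Lemma nonneg_rat (c : rat) : 0 <= c ->
  exists (a b : nat), (0 < b)%N /\ c * b%:R = a%:R.
Proof.
move=> c0; exists `|numq c|%N, `|denq c|%N; split; first by rewrite absz_gt0 denq_neq0.
rewrite !natr_absz !ger0_norm ?numq_ge0// ?denq_ge0//.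
by rewrite -[X in X * _]divq_num_den divfK// intr_eq0 denq_neq0.
Qed.

Lemma T_sum_hilb_nseq a bs j :
  T n (sum_hilb (flatten (nseq a bs))) j = a%:R * T n (sum_hilb bs) j.
Proof.
rewrite !T_sum_hilb; elim: a => [|a IH]; first by rewrite big_nil mul0r.
by rewrite /= big_cat /= IH -natr1 mulrDl mul1r addrC.
Qed.

Lemma realizable_cone : cone_closed realizable.
Proof.
split.
  by exists 1%N, [::]; split=> // j; rewrite T_sum_hilb big_nil mulr0.
move=> c d f g /nonneg_rat[p1 [q1 [q10 cE]]] /nonneg_rat[p2 [q2 [q20 dE]]].
move=> [N1 [bs1 [N10 all1 H1]]] [N2 [bs2 [N20 all2 H2]]].
(* Since [c = p1 / q1] and [d = p2 / q2], this factor turns both coefficients into whole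
   multiplicities. *)
exists (N1 * N2 * q1 * q2)%N, (flatten (nseq (p1 * q2 * N2) bs1) ++
  flatten (nseq (p2 * q1 * N1) bs2)).
have all_rep a bs : all (fun b => (b.1 <= n)%N) bs ->
    all (fun b => (b.1 <= n)%N) (flatten (nseq a bs)).
  by move=> Hbs; elim: a => //= a IH; rewrite all_cat Hbs.
split; first by rewrite !muln_gt0 N10 N20 q10.
  by rewrite all_cat !all_rep.
move=> j; rewrite T_sum_hilb big_cat /= -!T_sum_hilb !T_sum_hilb_nseq -H1 -H2.
by rewrite !natrM -cE -dE; ring.
Qed.

Lemma realizable_generator p e : (p <= n)%N -> realizable (iter p psum (delta e)).
Proof.
(* This is the constant of [T_power_std] for the block with [q = n - p]. *)
move=> pn; exists ((n - p + e).+1 * count (in_first (n - p).+1) (monomials n.+1 e))%N.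
exists [:: (n - p, e)%N]; split.
- by rewrite muln_gt0 /= -(ltr0n rat); apply: nvar_count_gt0.
- by rewrite /= leq_subr.
- move=> j; rewrite T_sum_hilb big_seq1 /block_hilb.
  by rewrite (@T_power_std n p) ?subnK// natrM.
Qed.

Lemma pos_realizable a g : V n a g -> (forall j, 0 <= g j) -> realizable g.
Proof.
move=> Vg; apply: cone_generators realizable_cone _ _; last first.
  by exists `|(a + n%:Z)%R|.+1 => j; apply: (VP n a g).1.
exact: realizable_generator.
Qed.

End Blocks.

Theorem theorem1p2 (k : fieldType) (n : nat) (a : int) (ha : - n%:Z <= a) :
  T n @` Q k n a = closed_convex_hull n a (nat_valued `&` V n a).
Proof.
apply/seteqP; split=> [_ [h Qh <-]|g Hg].
  (* The functions of [V] with nonnegative image form a closed convex set containing the Hilbert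
     functions, hence all of [Q]. *)
  have [|Vh Th] := hull_subset (halfspaces_closed_convex n a (T_comb n)) _ Qh.
    move=> f [[M [_ gen0 _ Mf]] Vf]; split=> //.
    exact: T_hilbert_ge0 gen0 Mf.
  by apply: pos_in_hull Th; apply: V_T.
have id_comb : comb_morph id by [].
have [|Vg g0] := hull_subset (halfspaces_closed_convex n a id_comb) _ Hg.
  by move=> f [Nf Vf]; split=> // j; apply: natr_ge0.
have [N [bs [N0 Hbs NT]]] := pos_realizable Vg g0.
(* The preimage is a Hilbert function divided by [N]; it is in [Q] because [Q] also contains 0, the
   Hilbert function of the empty direct sum. *)
exists (fun j => N%:R^-1 * sum_hilb n bs j); last first.
  apply/funext => j; rewrite -[RHS](mulKf (_ : N%:R != 0)) ?pnatr_eq0 -?lt0n//.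
  by rewrite NT /T; ring.
have V0 : V n a (fun=> 0).
  have := V_comb 0 0 Vg Vg; congr (V n a _); apply/funext => j.
  by rewrite !mul0r addr0.
apply: (hull_scale (N := N)) => //.
  move=> C [_ HC]; apply: HC; split=> //.
  have := sum_hilb_hilbert k n [::]; congr (hilbert_functions _ _ _).
  by apply/funext => j; rewrite /sum_hilb big_nil.
move=> C [_ HC]; apply: HC.
rewrite (_ : (fun j => _) = sum_hilb n bs); last first.
  by apply/funext => j; rewrite mulVKf// pnatr_eq0 -lt0n.
split; first exact: sum_hilb_hilbert.
(* It suffices that the image under [T n], which is [N] times [g], lies in [V]. *)
apply: V_sum_hilb => //.
have := V_comb N%:R 0 Vg Vg; congr (V n a _); apply/funext => j.
by rewrite mul0r addr0.
Qed.
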